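(* Let $n\ge 1$ and let $\Pi\subseteq\mathfrak{S}_n$. Suppose that the quasisymmetric generating function $Q(\Pi)$ is a symmetric function with power sum expansion $Q(\Pi)=q(p_1,p_2,p_3,\dots)=\sum_{\lambda\vdash n}c_\lambda p_\lambda$. Then: (a) $$\frac{1}{1+y}\left(\frac{1+yt}{1-t}\right)^{n+1}P^{(\mathrm{pk},\mathrm{des})}\left(\Pi;\frac{(1+y)^2t}{(y+t)(1+yt)},\frac{y+t}{1+yt}\right)=\sum_{k=0}^\infty\Theta_{y,k}(Q(\Pi))\,t^k=\sum_{\lambda\vdash n}c_\lambda\frac{A_{l(\lambda)}(t)}{(1-t)^{l(\lambda)+1}}\prod_{k=1}^{l(\lambda)}\bigl(1-(-y)^{\lambda_k}\bigr).$$ (b) $$\frac12\left(\frac{1+t}{1-t}\right)^{n+1}P^{\mathrm{pk}}\left(\Pi;\frac{4t}{(1+t)^2}\right)=\sum_{k=0}^\infty\Theta_{1,k}(Q(\Pi))\,t^k=\sum_{\substack{\lambda\vdash n\\ \text{odd}}}c_\lambda 2^{l(\lambda)}\frac{A_{l(\lambda)}(t)}{(1-t)^{l(\lambda)+1}}=\sum_{k=1}^n a_k2^k\frac{A_k(t)}{(1-t)^{k+1}},$$ where $\sum_{k=1}^n a_kw^k=q(w,0,w,0,w,0,\dots)$ and the third sum is over partitions $\lambda$ of $n$ all of whose parts are odd. (c) $$\frac{A(\Pi;t)}{(1-t)^{n+1}}=\sum_{k=0}^\infty\Theta_{0,k}(Q(\Pi))\,t^k=\sum_{\lambda\vdash n}c_\lambda\frac{A_{l(\lambda)}(t)}{(1-t)^{l(\lambda)+1}}=\sum_{k=1}^n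 b_k\frac{A_k(t)}{(1-t)^{k+1}},$$ where $\sum_{k=1}^n b_kw^k=q(w,w,w,\dots)$.
   Context: $\mathfrak{S}_n$ is the set of permutations $\pi=\pi(1)\cdots\pi(n)$ of $[n]=\{1,\dots,n\}$. An index $i\in[n-1]$ is a descent of $\pi$ if $\pi(i)>\pi(i+1)$; $\mathrm{des}(\pi)$ is the number of descents. An index $i\in\{2,\dots,n-1\}$ is a peak of $\pi$ if $\pi(i-1)<\pi(i)>\pi(i+1)$; $\mathrm{pk}(\pi)$ is the number of peaks. For $\Pi\subseteq\mathfrak{S}_n$ put $P^{(\mathrm{pk},\mathrm{des})}(\Pi;y,t)=\sum_{\pi\in\Pi}y^{\mathrm{pk}(\pi)+1}t^{\mathrm{des}(\pi)+1}$, $P^{\mathrm{pk}}(\Pi;t)=\sum_{\pi\in\Pi}t^{\mathrm{pk}(\pi)+1}$, $A(\Pi;t)=\sum_{\pi\in\Pi}t^{\mathrm{des}(\pi)+1}$. The Eulerian polynomials are $A_n(t)=\sum_{\pi\in\mathfrak{S}_n}t^{\mathrm{des}(\pi)+1}$ for $n\ge1$, and $A_0(t)=1$. Quasisymmetric generating function: $Q(\Pi)=\sum_{\pi\in\Pi}F_\pi$, where, for $\pi\in\mathfrak{S}_n$, $F_\pi=\sum x_{i_1}x_{i_2}\cdots x_{i_n}$, the sum being over all positive integers $i_1\le i_2\le\cdots\le i_n$ with $i_j<i_{j+1}$ whenever $j$ is a descent of $\pi$ (this is the fundamental quasisymmetric function of the descent composition of $\pi$). $\Lambda$ is the $\mathbb{Q}$-algebra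 of symmetric functions in $x_1,x_2,\dots$; $p_i=\sum_j x_j^i$ and $p_\lambda=p_{\lambda_1}p_{\lambda_2}\cdots$ are the power sums; $q$ denotes the polynomial expressing $Q(\Pi)$ in $p_1,p_2,\dots$; $l(\lambda)$ is the number of parts of a partition $\lambda=(\lambda_1,\lambda_2,\dots)$. Plethysm: for $a$ in a $\mathbb{Q}$-algebra of formal power series, $f\mapsto f[a]$ is the $\mathbb{Q}$-algebra homomorphism on $\Lambda$ such that $p_i[a]$ is obtained from $a$ by replacing every variable by its $i$th power. For $k\in\mathbb{Z}$, $\Theta_{y,k}(f)=f[k(1-\alpha)]\big|_{\alpha=-y}$, where $\alpha$ is a variable; that is, $\Theta_{y,k}$ is the $\mathbb{Q}$-algebra homomorphism on $\Lambda$ with $\Theta_{y,k}(p_i)=k(1-(-y)^i)$. $\Theta_{1,k}$ and $\Theta_{0,k}$ are the cases $y=1$ and $y=0$. Rational functions of $y,t$ are expanded as formal power series in $t$. *)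

(* Defs.v *)
From Stdlib Require Import ClassicalEpsilon.
From HB Require Import structures.
From mathcomp Require Import all_boot all_order all_fingroup all_algebra.
From mathcomp Require Import fraction mpoly.

Set Implicit Arguments.
Unset Strict Implicit.
Unset Printing Implicit Defensive.

Import GRing.Theory.
Local Open Scope ring_scope.

(* Positions and letters are 0-based: pi : 'S_n is the word
   pi(0) ... pi(n-1) on the letters 0, ..., n-1. *)
Definition is_des n (pi : 'S_n) (i : 'I_n) : bool :=
  [exists j : 'I_n, (j == i.+1 :> nat) && (pi j < pi i)%N].

Definition des n (pi : 'S_n) : nat := #|[set i | is_des pi i]|.

Definition is_peak n (pi : 'S_n) (i : 'I_n) : bool :=
  [exists h : 'I_n, exists j : 'I_n,
    [&& i == h.+1 :> nat, j == i.+1 :> nat, (pi h < pi i)%N & (pi j < pi i)%N]].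

Definition pk n (pi : 'S_n) : nat := #|[set i | is_peak pi i]|.

Definition Ppkdes (R : comNzRingType) n (Pi : {set 'S_n}) (y t : R) : R :=
  \sum_(pi in Pi) y ^+ (pk pi).+1 * t ^+ (des pi).+1.

Definition Ppk (R : comNzRingType) n (Pi : {set 'S_n}) (t : R) : R :=
  \sum_(pi in Pi) t ^+ (pk pi).+1.

Definition Ades (R : comNzRingType) n (Pi : {set 'S_n}) (t : R) : R :=
  \sum_(pi in Pi) t ^+ (des pi).+1.

Definition eulerian (R : comNzRingType) (n : nat) (t : R) : R :=
  if n is 0 then 1 else Ades [set: 'S_n] t.

(* A formal power series of bounded degree in x_0, x_1, ... is represented by
   the sequence of its truncations f N = f(x_0, ..., x_{N-1}, 0, 0, ...). *)
Definition series : Type := forall N : nat, {mpoly rat[N]}.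

(* The substitution x_N := 0. *)
Definition drop_last_var N (p : {mpoly rat[N.+1]}) : {mpoly rat[N]} :=
  p \mPo [tuple if unlift ord_max i is Some j then 'X_j else 0 | i < N.+1].

(* The elements of Lambda, i.e. of the inverse limit, in the category of graded
   rings, of the rings of symmetric polynomials in N variables. *)
Definition symfun (f : series) : Prop :=
  [/\ forall N, f N \is symmetric,
      forall N, drop_last_var (f N.+1) = f N
    & exists d : nat, forall N, (msize (f N) <= d)%N].

Definition psum (i : nat) : series := fun N => \sum_(j < N) 'X_j ^+ i.

(* i is weakly increasing, and strictly increasing at the descents of pi. *)
Definition compatible n N (pi : 'S_n) (i : {ffun 'I_n -> 'I_N}) : bool :=
  [forall j : 'I_n, forall j' : 'I_n, (j' == j.+1 :> nat) ==>
    (if is_des pi j then (i j < i j')%N else (i j <= i j')%N)].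

Definition Fqsym n (pi : 'S_n) : series := fun N =>
  \sum_(i : {ffun 'I_n -> 'I_N} | compatible pi i) \prod_(j < n) 'X_(i j).

Definition Qgf n (Pi : {set 'S_n}) : series := fun N =>
  \sum_(pi in Pi) Fqsym pi N.

(* Partitions of n, padded with zeros to length n. *)
Definition intpart (n : nat) : Type :=
  {l : n.-tuple 'I_n.+1 |
    sorted geq (map val l) && (sumn (map val l) == n)}.

Definition parts n (la : intpart n) : seq nat :=
  [seq i <- map val (val la) | (0 < i)%N].

Definition psum_part n (la : intpart n) : series := fun N =>
  \prod_(i <- parts la) psum i N.

(* phi is f |-> f[a] on Lambda, for a in Q[alpha]; a \Po 'X^i is a with alpha
   replaced by alpha^i. *)
Record is_plethysm (a : {poly rat}) (phi : series -> {poly rat}) : Prop :=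
  IsPlethysm {
    plethysm1 : phi (fun N => 1) = 1;
    plethysmD : forall f g, symfun f -> symfun g ->
      phi (fun N => f N + g N) = phi f + phi g;
    plethysmM : forall f g, symfun f -> symfun g ->
      phi (fun N => f N * g N) = phi f * phi g;
    plethysmZ : forall (r : rat) f, symfun f ->
      phi (fun N => r *: f N) = r *: phi f;
    plethysm_psum : forall i, (0 < i)%N -> phi (psum i) = a \Po 'X^i }.

(* The Q-algebra homomorphism f |-> f[a]; since the power sums freely generate
   Lambda, it exists and its values on Lambda are unique. *)
Definition plethysm (a : {poly rat}) : series -> {poly rat} :=
  epsilon (inhabits (fun=> 0)) (is_plethysm a).

(* f[k(1 - alpha)] evaluated at alpha = - y; K has characteristic 0 in use. *)
Definition Theta (K : fieldType) (y : K) (k : int) (f : series) : K :=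
  (map_poly ratr (plethysm (k%:~R * (1 - 'X)) f)).[- y].

(* The rational function r is regular at t = 0, with Taylor series
   \sum_k s k t^k. *)
Definition expands (K : fieldType) (r : {fraction {poly K}}) (s : nat -> K) :
    Prop :=
  exists num den : {poly K},
    [/\ den`_0 != 0, r = tofrac num / tofrac den
      & forall m : nat, \sum_(i < m.+1) den`_i * s (m - i)%N = num`_m].

(* Q(y), its generator, and the elements y and t of Q(y)(t). *)
Definition Qy : fieldType := {fraction {poly rat}}.
Definition yvar : Qy := tofrac 'X.
Definition yc : {fraction {poly Qy}} := tofrac yvar%:P.
Definition tvar (K : fieldType) : {fraction {poly K}} := tofrac 'X.

(* Main.v *)
Require Import Defs.
From HB Require Import structures.
From mathcomp Require Import all_boot all_order all_fingroup all_algebra.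
From mathcomp Require Import mpoly ring zify.
From Stdlib Require Import FunctionalExtensionality ClassicalEpsilon.

Set Implicit Arguments.
Unset Strict Implicit.
Unset Printing Implicit Defensive.

Import GRing.Theory Num.Theory.
Local Open Scope ring_scope.

(** Everything is read off from finite alphabets. Adding one letter x at the end
    of the alphabet of F_pi changes the values of the F of all prefixes of pi by
    a unipotent linear operator T_x on vectors indexed by the prefix length, so
    that F_pi (x_1, ..., x_N) is the last entry of T_(x_N) ... T_(x_1) applied
    to (1, 0, ..., 0) ([eval_Fqsym]). As T_x is unipotent, T_x^m is polynomial
    in m and T_x^-1 is its value at m = -1, while m copies of x contribute
    m x^a to the power sum p_a and the value at m = -1 is - x^a. Hence an
    expansion Q(Pi) = sum_lambda c_lambda p_lambda, which is an identity between
    values at all finite alphabets, remains true on signed alphabets, where a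
    negative letter acts by T_x^-1 ([superization]).

    The alphabet made of k copies of a block, a negative letter - y followed by a
    positive letter 1, has power sums p_a = k (1 - (- y)^a), which is the effect of
    Theta_(y,k). So Theta_(y,k)(Q(Pi)) is the sum over pi of the last entry of
    (T_1 T_(-y)^-1)^k (1, 0, ..., 0). For a single pi, the generating function
    in t of these numbers is computed one position of pi at a time: an ascent, a
    descent after a descent and a peak each multiply it by an explicit rational
    factor, which yields
      1/(1+y) ((1+yt)/(1-t))^(n+1) Y^(pk+1) T^(des+1)
    with Y and T the two arguments on the left of (a)
    ([expands_superblocks]). This is the first equality of (a).

    For the second one, Theta_(y,k)(p_lambda) is k^l(lambda) times the product
    of the 1 - (- y)^(lambda_i), and sum_k k^l t^k = A_l(t)/(1-t)^(l+1). The
    latter is the case y = 0 of the first equality for all of S_l, since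
    Q(S_l) = p_1^l: every word becomes weakly increasing by exactly one stable
    sorting permutation ([Qgf_all]). Parts (b) and (c) are the cases y = 1 and
    y = 0. The specializations of q are compared with the c_lambda by evaluating
    q on the same signed alphabets, for all k ([mpoly_select]).

    Finally, the homomorphism f |-> f[k(1 - alpha)] has to exist. For symmetric
    f, the value of f at k letters 1 and m letters alpha is a polynomial in m,
    because iterated differences of order larger than the degree of f vanish
    ([eval_series_nseq_poly]); its value at m = -k is f[k(1 - alpha)]. *)

(** * Difference equations and the letter operators *)

Lemma rat_natr_inj (L : comNzRingType) (emb : {rmorphism rat -> L}) :
  injective (fun m : nat => m%:R : L).
Proof.
move=> m1 m2 /= eq_m; apply/eqP; rewrite -(eqr_nat rat); apply/eqP.
by apply: (fmorph_inj emb); rewrite !rmorph_nat.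
Qed.

Lemma poly_eq_on_multiples (L : idomainType) (emb : {rmorphism rat -> L})
    (u : L) (p q : {poly L}) :
  u != 0 -> (forall m : nat, p.[m%:R * u] = q.[m%:R * u]) -> p = q.
Proof.
move=> u0 eq_pq; apply/eqP; rewrite -subr_eq0; apply/negPn/negP => nz.
pose rs := [seq m%:R * u | m <- iota 0 (size (p - q))].
have /(max_poly_roots nz) : all (root (p - q)) rs.
  by apply/allP=> _ /mapP[m _ ->]; rewrite rootE hornerD hornerN eq_pq subrr.
rewrite map_inj_uniq ?iota_uniq ?size_map ?size_iota ?ltnn; last first.
  by move=> m1 m2 /(mulIf u0); apply: rat_natr_inj emb _ _.
by move=> /(_ isT).
Qed.

Lemma poly_eq_on_nat (L : idomainType) (emb : {rmorphism rat -> L})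
    (p q : {poly L}) :
  (forall m : nat, p.[m%:R] = q.[m%:R]) -> p = q.
Proof.
move=> eq_pq; apply: (poly_eq_on_multiples emb (oner_neq0 L)) => m.
by rewrite mulr1.
Qed.

(** The binomial expansion of (x + 1)^(d + 1) - x^(d + 1) has leading term
    (d + 1) x^d, so the antidifferences of lower powers give that of x^d. *)
Lemma monomial_antidifference (L : comNzRingType) (emb : {rmorphism rat -> L})
    (d : nat) :
  exists P : {poly L}, forall x, P.[x + 1] = P.[x] + x ^+ d.
Proof.
elim/ltn_ind: d => d IHd.
have /fin_all_exists[P PE] (i : 'I_d) :
    exists P : {poly L}, forall x, P.[x + 1] = P.[x] + x ^+ i.
  exact: IHd.
pose u := emb (d.+1%:R^-1).
have uE : u * d.+1%:R = 1.
  by rewrite -(rmorph_nat emb) -rmorphM mulVf ?rmorph1 // pnatr_eq0.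
exists (u%:P * ('X^(d.+1) - \sum_(i < d) P i *+ 'C(d.+1, i))) => x.
rewrite !hornerM !hornerC !hornerD !hornerN !hornerXn !horner_sum.
under eq_bigr => i _ do rewrite hornerMn PE mulrnDl.
rewrite big_split /= exprD1n !big_ord_recr /= binn binSn.
under [X in _ = _ * (_ - X) + _]eq_bigr => i _ do rewrite hornerMn.
rewrite -[x ^+ d in RHS]mul1r -uE -(mulr_natr (x ^+ d)).
ring.
Qed.

Lemma poly_antidifference (L : comNzRingType) (emb : {rmorphism rat -> L})
    (p : {poly L}) (c : L) :
  exists P : {poly L}, P.[0] = c /\ forall x, P.[x + 1] = P.[x] + p.[x].
Proof.
have /fin_all_exists[P PE] (i : 'I_(size p)) :
    exists P : {poly L}, forall x, P.[x + 1] = P.[x] + x ^+ i.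
  exact: monomial_antidifference emb i.
pose P0 := \sum_(i < size p) p`_i *: P i.
exists (P0 + (c - P0.[0])%:P); split=> [|x].
  by rewrite hornerD hornerC addrC subrK.
rewrite !hornerD !hornerC !horner_sum (horner_coef p).
under eq_bigr => i _ do rewrite hornerZ PE mulrDr.
under [X in _ = X + _ + _]eq_bigr => i _ do rewrite hornerZ.
rewrite big_split /=; ring.
Qed.

(** Entry j of a vector S is the value, on the alphabet read so far, of the
    fundamental quasisymmetric function of the prefix of length j. After a new
    largest letter x, either that prefix does not use x, or its last position
    takes x and leaves a prefix of length j - 1: on the old alphabet if the step
    before the last position is a descent, and on the new one if it is an
    ascent. [D i] says that the step into position i (counted from 0) is a
    descent. *)
Fixpoint addletter (L : comNzRingType) (D : pred nat) (x : L) (S : nat -> L)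
    (j : nat) : L :=
  if j is i.+1 then S i.+1 + x * (if D i then S i else addletter D x S i)
  else S 0.

(** The inverse of [addletter]. *)
Fixpoint remletter (L : comNzRingType) (D : pred nat) (x : L) (S : nat -> L)
    (j : nat) : L :=
  if j is i.+1 then S i.+1 - x * (if D i then remletter D x S i else S i)
  else S 0.

(** A letter is a pair whose first component tells whether it is negative. *)
Definition actletter (L : comNzRingType) (D : pred nat) (l : bool * L) :
    (nat -> L) -> nat -> L :=
  if l.1 then remletter D l.2 else addletter D l.2.

Definition actword (L : comNzRingType) (D : pred nat) (w : seq (bool * L))
    (S : nat -> L) : nat -> L :=
  foldl (fun S l => actletter D l S) S w.

Definition emptyvec (L : comNzRingType) (j : nat) : L := (j == 0)%:R.

Lemma actletter_ext (L : comNzRingType) D (l : bool * L) S S' :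
  S =1 S' -> actletter D l S =1 actletter D l S'.
Proof.
by case: l => [[] x] eqS; elim=> [|j] /=; rewrite /actletter /= ?eqS // => ->.
Qed.

Lemma actword_ext (L : comNzRingType) D (w : seq (bool * L)) S S' :
  S =1 S' -> actword D w S =1 actword D w S'.
Proof.
elim: w S S' => //= l w IHw S S' eqS.
exact/IHw/actletter_ext.
Qed.

Lemma actword_cat (L : comNzRingType) D (w1 w2 : seq (bool * L)) S :
  actword D (w1 ++ w2) S = actword D w2 (actword D w1 S).
Proof. exact: foldl_cat. Qed.

Lemma actletter_morph (L M : comNzRingType) (f : {rmorphism L -> M}) D
    (l : bool * L) S j :
  f (actletter D l S j) = actletter D (l.1, f l.2) (f \o S) j.
Proof.
case: l => [[] x]; rewrite /actletter /=; elim: j => //= j IHj.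
  by rewrite rmorphB rmorphM; case: ifP => // _; rewrite IHj.
by rewrite rmorphD rmorphM; case: ifP => // _; rewrite IHj.
Qed.

Lemma actword_morph (L M : comNzRingType) (f : {rmorphism L -> M}) D
    (w : seq (bool * L)) S j :
  f (actword D w S j) = actword D [seq (l.1, f l.2) | l <- w] (f \o S) j.
Proof.
elim: w S => //= l w IHw S; rewrite IHw; apply: actword_ext => i /=.
exact: actletter_morph.
Qed.

(** Entry j + 1 of T_x^m S is obtained by summing over m a polynomial in m given
    by entry j. The polynomials found this way satisfy the recursion of
    [addletter] identically, and its instance from -1 to 0 is the recursion of
    [remletter]. *)
Lemma actword_nseq_poly (L : comNzRingType) (emb : {rmorphism rat -> L})
    (D : pred nat) (x : L) (S : nat -> L) :
  exists B : nat -> {poly L},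
    (forall (m : nat) j, (B j).[m%:R] = actword D (nseq m (false, x)) S j)
    /\ forall j, (B j).[-1] = remletter D x S j.
Proof.
suff [B [B0 BD]] : exists B : nat -> {poly L}, (forall j, (B j).[0] = S j) /\
    forall y j, (B j).[y + 1] = addletter D x (fun i => (B i).[y]) j.
  exists B; split=> [m j|].
    elim: m j => [|m IHm] j; first by rewrite B0.
    rewrite -natr1 BD -addn1 nseqD actword_cat /=.
    by apply: (@actletter_ext _ _ (false, x)) => i; rewrite IHm.
  elim=> [|j IHj] /=.
    by move: (BD (-1) 0); rewrite addNr B0 /=.
  move: (BD (-1) j.+1) (BD (-1) j) => /=; rewrite addNr !B0 => -> <-.
  by rewrite IHj addrK.
pose anti p c := epsilon (inhabits 0) (fun P : {poly L} =>
  P.[0] = c /\ forall y, P.[y + 1] = P.[y] + p.[y]).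
have antiP p c : (anti p c).[0] = c /\
    forall y, (anti p c).[y + 1] = (anti p c).[y] + p.[y].
  exact: epsilon_spec (poly_antidifference emb p c).
pose B := fix B j := if j is i.+1 then
  anti (x *: (if D i then B i else B i \Po ('X + 1))) (S i.+1) else (S 0)%:P.
exists B; split=> [[|j]|y] /=; first by rewrite hornerC.
  by case: (antiP (x *: (if D j then B j else B j \Po ('X + 1))) (S j.+1)).
elim=> [|j IHj] /=; first by rewrite !hornerC.
set p := (X in anti X _); have [_ ->] := antiP p (S j.+1).
rewrite /p hornerZ; case: ifP => // _.
by rewrite horner_comp !hornerE IHj.
Qed.

(** * Fundamental quasisymmetric functions on finite alphabets *)

Lemma mmap_mmap (L : comNzRingType) (emb : {rmorphism rat -> L}) n k
    (g : 'I_n -> {mpoly rat[k]}) (h : 'I_k -> L) (p : {mpoly rat[n]}) :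
  mmap emb h (mmap (@mpolyC k rat) g p) =
  mmap emb (fun i => mmap emb h (g i)) p.
Proof.
rewrite [mmap (@mpolyC _ _) g p]/mmap rmorph_sum; apply: eq_bigr => m _ /=.
rewrite rmorphM /= mmapC; congr (_ * _).
by rewrite rmorph_prod; apply: eq_bigr => i _; rewrite rmorphXn.
Qed.

Lemma eq_mmap (L : comNzRingType) (emb : {rmorphism rat -> L}) n
    (h h' : 'I_n -> L) (p : {mpoly rat[n]}) :
  h =1 h' -> mmap emb h p = mmap emb h' p.
Proof. by move=> eqh; apply: eq_bigr => m _; rewrite (mmap1_eq _ eqh). Qed.

Definition eval_series (L : comNzRingType) (emb : {rmorphism rat -> L})
    (f : series) (xs : seq L) : L :=
  mmap emb (fun i : 'I_(size xs) => xs`_i) (f (size xs)).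

(** There is no step into position 0. Counting it as a descent is harmless for
    the operators, since entry 0 of their vectors is constant, and it prevents a
    descent into position 1 from counting as a peak. *)
Definition steps n (pi : 'S_n) (j : nat) : bool :=
  if j is i.+1 then [exists k : 'I_n, (k == i :> nat) && is_des pi k] else true.

Lemma stepsS n (pi : 'S_n) (j : 'I_n) : steps pi j.+1 = is_des pi j.
Proof.
apply/existsP/idP => [[k /andP[/eqP kj]]|des_j]; last by exists j; rewrite eqxx.
by rewrite (val_inj kj).
Qed.

(** The condition of [compatible], for an arbitrary descent pattern, so that it
    passes to prefixes. *)
Definition monotone_for (D : pred nat) n N (i : {ffun 'I_n -> 'I_N}) : bool :=
  [forall j : 'I_n, forall j' : 'I_n, (j' == j.+1 :> nat) ==>
    (if D j.+1 then (i j < i j')%N else (i j <= i j')%N)].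

Definition last_below n N (i : {ffun 'I_n -> 'I_N}) (b : nat) : bool :=
  [forall j : 'I_n, (j.+1 == n) ==> (i j < b)%N].

(** The sum over the sequences of length n with last entry below b, organised by
    that entry v: the previous entry is below v or below v + 1 according to the
    step. *)
Fixpoint chain_sum (L : comNzRingType) (D : pred nat) (x : nat -> L)
    (n b : nat) : L :=
  if n is m.+1 then
    \sum_(v < b) x v * chain_sum D x m (if D m then v : nat else v.+1)
  else 1.

Definition ffun_snoc n (T : Type) (p : {ffun 'I_n -> T}) (v : T) :
    {ffun 'I_n.+1 -> T} :=
  [ffun j => if unlift ord_max j is Some k then p k else v].

Lemma ffun_snoc_lift n T (p : {ffun 'I_n -> T}) v k :
  ffun_snoc p v (lift ord_max k) = p k.
Proof. by rewrite ffunE liftK. Qed.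

Lemma ffun_snoc_max n T (p : {ffun 'I_n -> T}) v : ffun_snoc p v ord_max = v.
Proof. by rewrite ffunE unlift_none. Qed.

Lemma monotone_for_snoc D n N (p : {ffun 'I_n -> 'I_N}) v b :
  monotone_for D (ffun_snoc p v) && last_below (ffun_snoc p v) b =
  (v < b)%N &&
  (monotone_for D p && last_below p (if D n then v : nat else v.+1)).
Proof.
apply/andP/and3P => [[/forallP mono /forallP lst]|
                       [v_b /forallP mono /forallP lst]].
  split.
  - by move: (lst ord_max) => /=; rewrite eqxx ffun_snoc_max.
  - apply/forallP => j; apply/forallP => j'; apply/implyP => /eqP jj'.
    move: (mono (lift ord_max j)) => /forallP /(_ (lift ord_max j')).
    by rewrite !ffun_snoc_lift !lift_max jj' eqxx.
  - apply/forallP => j; apply/implyP => /eqP jn.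
    move: (mono (lift ord_max j)) => /forallP /(_ ord_max).
    by rewrite ffun_snoc_lift ffun_snoc_max !lift_max jn eqxx; case: ifP.
split; last first.
  apply/forallP => j; apply/implyP => /eqP [jn].
  by rewrite (_ : j = ord_max) ?ffun_snoc_max //; apply: val_inj.
apply/forallP => j; apply/forallP => j'; apply/implyP => /eqP.
case: (unliftP ord_max j) => [k ->|->]; last first.
  by move=> jj'; have := ltn_ord j'; rewrite jj' ltnn.
rewrite lift_max ffun_snoc_lift.
case: (unliftP ord_max j') => [k' ->|->]; rewrite ?lift_max => kk'.
  move: (mono k) => /forallP /(_ k'); rewrite kk' eqxx /=.
  by rewrite ffun_snoc_lift.
move: (lst k); rewrite ffun_snoc_max -kk' eqxx /=.
by case: ifP.
Qed.

Lemma sum_monotone_for (L : comNzRingType) D (x : nat -> L) n N b :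
  (b <= N)%N ->
  \sum_(i : {ffun 'I_n -> 'I_N} | monotone_for D i && last_below i b)
     \prod_(j < n) x (i j) = chain_sum D x n b.
Proof.
elim: n b => [|n IHn] b b_N /=.
  under eq_bigr => i _ do rewrite big_ord0.
  rewrite (big_pred1 (ffun0 (card_ord 0))) // => i /=.
  rewrite -(_ : true = (i == _)); last first.
    by apply/esym/eqP/ffunP => -[].
  by apply/andP; split; apply/forallP => -[].
rewrite (reindex (fun vp : 'I_N * {ffun 'I_n -> 'I_N} => ffun_snoc vp.2 vp.1))
  /=; last first.
  exists (fun i : {ffun 'I_n.+1 -> 'I_N} =>
    (i ord_max, [ffun j => i (lift ord_max j)])) => [[v p] _|i _] /=.
    congr pair; first exact: ffun_snoc_max.
    by apply/ffunP => j; rewrite ffunE ffun_snoc_lift.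
  apply/ffunP => j; case: (unliftP ord_max j) => [k|] ->.
    by rewrite ffun_snoc_lift ffunE.
  by rewrite ffun_snoc_max.
under eq_bigl => vp do rewrite monotone_for_snoc.
rewrite -(pair_big_dep (fun v : 'I_N => (v < b)%N) (fun v p =>
  monotone_for D p && last_below p (if D n then v : nat else v.+1))
  (fun v p => \prod_(j < n.+1) x (ffun_snoc p v j))) /=.
rewrite (big_ord_widen N
  (fun v => x v * chain_sum D x n (if D n then v else v.+1))) //.
apply: eq_bigr => v v_b.
rewrite -IHn; last by case: ifP => _ //; apply: ltnW.
rewrite big_distrr /=; apply: eq_bigr => p _.
rewrite big_ord_recr /= ffun_snoc_max mulrC; congr (_ * _).
apply: eq_bigr => j _; rewrite -(ffun_snoc_lift p v).
congr (x (nat_of_ord (ffun_snoc p v _))); apply: val_inj.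
exact: esym (lift_max j).
Qed.

Lemma chain_sum_actword (L : comNzRingType) D (x : nat -> L) b n :
  actword D [seq (false, x v) | v <- iota 0 b] (@emptyvec L) n =
  chain_sum D x n b.
Proof.
elim: b n => [|b IHb] n; first by case: n => //= n; rewrite big_ord0.
rewrite -[X in iota 0 X]addn1 iotaD map_cat actword_cat /= add0n.
elim: n => [|n IHn]; first by rewrite /actletter /= IHb.
rewrite /actletter /= IHb big_ord_recr /=; congr (_ + _ * _).
by move: IHn; rewrite /actletter /= => ->; rewrite IHb; case: ifP.
Qed.

Lemma eval_Fqsym (L : comNzRingType) (emb : {rmorphism rat -> L}) n
    (pi : 'S_n) (xs : seq L) :
  eval_series emb (Fqsym pi) xs =
  actword (steps pi) [seq (false, x) | x <- xs] (@emptyvec L) n.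
Proof.
have -> : [seq (false, x) | x <- xs] =
    [seq (false, xs`_v) | v <- iota 0 (size xs)].
  by rewrite -{1}(mkseq_nth 0 xs) -map_comp.
rewrite chain_sum_actword.
rewrite -(sum_monotone_for (steps pi) (nth 0 xs) n (leqnn (size xs))).
rewrite /eval_series /Fqsym rmorph_sum /=.
apply: eq_big => [i|i _]; last first.
  by rewrite rmorph_prod; apply: eq_bigr => j _ /=; rewrite mmapX mmap1U.
rewrite [last_below _ _](_ : _ = true) ?andbT; last first.
  by apply/forallP => j; rewrite ltn_ord implybT.
apply: eq_forallb => j; apply: eq_forallb => j'.
by rewrite stepsS.
Qed.

(** * Power sums on signed alphabets *)

Lemma eval_psum (L : comNzRingType) (emb : {rmorphism rat -> L}) a
    (xs : seq L) :
  eval_series emb (psum a) xs = \sum_(x <- xs) x ^+ a.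
Proof.
rewrite /eval_series /psum rmorph_sum /= (big_nth 0) big_mkord.
by apply: eq_bigr => j _; rewrite rmorphXn /= mmapX mmap1U.
Qed.

Definition signed_psum (L : comNzRingType) (a : nat) (w : seq (bool * L)) : L :=
  \sum_(l <- w) (if l.1 then - l.2 ^+ a else l.2 ^+ a).

Lemma signed_psum_nseq (L : comNzRingType) a m (l : bool * L) :
  signed_psum a (nseq m l) = (if l.1 then - l.2 ^+ a else l.2 ^+ a) *+ m.
Proof. by rewrite /signed_psum big_nseq -Monoid.iteropE. Qed.

Lemma actword_poly (L : comNzRingType) (emb : {rmorphism rat -> L})
    (D : pred nat) (w1 w2 : seq (bool * L)) (x : L) (S : nat -> L) (j : nat) :
  exists H : {poly L},
    (forall m : nat,
       H.[m%:R] = actword D (w1 ++ nseq m (false, x) ++ w2) S j)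
    /\ H.[-1] = actword D (w1 ++ (true, x) :: w2) S j.
Proof.
have [B [BN B1]] := actword_nseq_poly emb D x (actword D w1 S).
pose w2P := [seq (l.1, l.2%:P) | l <- w2].
have w2PE z : [seq (l.1, horner_eval z l.2) | l <- w2P] = w2.
  rewrite -map_comp -[RHS]map_id; apply: eq_map => -[b y] /=.
  by rewrite /horner_eval hornerC.
exists (actword D w2P B j); split=> [m|].
  rewrite -/(horner_eval _ _) actword_morph w2PE !actword_cat.
  by apply: actword_ext => i /=; rewrite /horner_eval BN.
rewrite -/(horner_eval _ _) actword_morph w2PE actword_cat.
by apply: actword_ext => i /=; rewrite /horner_eval B1.
Qed.

(** One negative letter is the case m = -1 of m positive copies of it, so that
    properties which are polynomial identities in m pass to signed words. *)
Lemma signed_word_ind (L : comNzRingType) (P : seq (bool * L) -> Prop) :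
  (forall xs, P [seq (false, x) | x <- xs]) ->
  (forall w1 w2 x, (forall m, P (w1 ++ nseq m (false, x) ++ w2)) ->
     P (w1 ++ (true, x) :: w2)) ->
  forall w, P w.
Proof.
move=> Ppos Pneg w; have [k] := ubnP (count fst w).
elim: k w => // k IHk w; rewrite ltnS => w_k.
have [/hasP[[b x] xw bT]|pos] := boolP (has fst w); last first.
  have -> : w = [seq (false, x) | x <- [seq l.2 | l <- w]]; last exact: Ppos.
  rewrite -map_comp -[LHS]map_id; apply/eq_in_map => -[b y] /=.
  by case: b => // /(hasPn pos).
move: bT xw => /= -> xw; case/splitPr: xw w_k => w1 w2 w_k.
apply: Pneg => m; apply: IHk.
by move: w_k; rewrite !count_cat /= count_nseq /= mul0n; lia.
Qed.

(** The power sum of w1, m copies of x and w2, as a polynomial in m. *)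
Definition psum_poly (L : comNzRingType) (w1 w2 : seq (bool * L)) (x : L) a :
    {poly L} :=
  (signed_psum a w1 + signed_psum a w2)%:P + x ^+ a *: 'X.

Lemma psum_poly_nat (L : comNzRingType) (w1 w2 : seq (bool * L)) x a (m : nat) :
  (psum_poly w1 w2 x a).[m%:R] =
  signed_psum a (w1 ++ nseq m (false, x) ++ w2).
Proof.
rewrite hornerD hornerC hornerZ hornerX.
rewrite mulr_natr -(signed_psum_nseq a m (false, x)).
rewrite /signed_psum !big_cat /=; ring.
Qed.

Lemma psum_poly_neg1 (L : comNzRingType) (w1 w2 : seq (bool * L)) x a :
  (psum_poly w1 w2 x a).[-1] = signed_psum a (w1 ++ (true, x) :: w2).
Proof.
rewrite hornerD hornerC hornerZ hornerX.
rewrite /signed_psum big_cat big_cons /=; ring.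
Qed.

(** The value of sum_i c_i p_(ps i) when each p_a takes the value v a. *)
Definition psum_value (L : comNzRingType) (emb : {rmorphism rat -> L})
    (I : finType) (c : I -> rat) (ps : I -> seq nat) (v : nat -> L) : L :=
  \sum_i emb (c i) * \prod_(a <- ps i) v a.

Lemma horner_psum_value (L : comNzRingType) (emb : {rmorphism rat -> L})
    (I : finType) (c : I -> rat) (ps : I -> seq nat) (v : nat -> {poly L}) z :
  (\sum_i (emb (c i))%:P * \prod_(a <- ps i) v a).[z] =
  psum_value emb c ps (fun a => (v a).[z]).
Proof.
rewrite horner_sum; apply: eq_bigr => i _.
by rewrite hornerM hornerC horner_prod.
Qed.

Lemma eq_psum_value (L : comNzRingType) (emb : {rmorphism rat -> L})
    (I : finType) (c : I -> rat) (ps : I -> seq nat) (v v' : nat -> L) :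
  (forall i, {in ps i, v =1 v'}) ->
  psum_value emb c ps v = psum_value emb c ps v'.
Proof.
move=> eqv; apply: eq_bigr => i _; congr (_ * _).
by apply: eq_big_seq => a; apply: eqv.
Qed.

Lemma eval_series_psum_value (L : comNzRingType) (emb : {rmorphism rat -> L})
    (f : series) (I : finType) (c : I -> rat) (ps : I -> seq nat) (xs : seq L) :
  (forall N, f N = \sum_i c i *: \prod_(a <- ps i) psum a N) ->
  eval_series emb f xs =
  psum_value emb c ps (fun a => signed_psum a [seq (false, x) | x <- xs]).
Proof.
move=> fE; rewrite /eval_series fE rmorph_sum; apply: eq_bigr => i _ /=.
rewrite mmapZ rmorph_prod; congr (_ * _); apply: eq_bigr => a _ /=.
by rewrite -[LHS]/(eval_series emb (psum a) xs) eval_psum /signed_psum !big_map.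
Qed.

(** Both sides are polynomial in the number m of copies of a letter; they agree
    for natural m, hence for m = -1. A single [actword] depends on the order of
    the letters; the sum over Pi does not, as the right-hand side shows. *)
Lemma superization (K : idomainType) (emb : {rmorphism rat -> K}) n
    (Pi : {set 'S_n}) (I : finType) (c : I -> rat) (ps : I -> seq nat)
    (Qc : forall N, Qgf Pi N = \sum_i c i *: \prod_(a <- ps i) psum a N)
    (w : seq (bool * K)) :
  \sum_(pi in Pi) actword (steps pi) w (@emptyvec K) n =
  psum_value emb c ps (fun a => signed_psum a w).
Proof.
elim/signed_word_ind: w => [xs|w1 w2 x IHw].
  rewrite -(eval_series_psum_value emb xs Qc) /eval_series rmorph_sum /=.
  apply: eq_bigr => pi _.
  by rewrite -[RHS]/(eval_series emb (Fqsym pi) xs) eval_Fqsym.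
have /fin_all_exists[H HP] (pi : 'S_n) :=
  actword_poly emb (steps pi) w1 w2 x (@emptyvec K) n.
have HG : \sum_(pi in Pi) H pi =
    \sum_i (emb (c i))%:P * \prod_(a <- ps i) psum_poly w1 w2 x a.
  apply: (poly_eq_on_nat emb) => m; rewrite horner_sum horner_psum_value.
  transitivity (\sum_(pi in Pi) actword (steps pi)
      (w1 ++ nseq m (false, x) ++ w2) (@emptyvec K) n).
    by apply: eq_bigr => pi _; case: (HP pi).
  by rewrite IHw; apply: eq_psum_value => i a _; rewrite psum_poly_nat.
transitivity ((\sum_(pi in Pi) H pi).[-1]).
  by rewrite horner_sum; apply: eq_bigr => pi _; case: (HP pi).
rewrite HG horner_psum_value; apply: eq_psum_value => i a _.
exact: psum_poly_neg1.
Qed.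

(** The argument of [superization] gives q and the power sum expansion the same
    values at the power sums of every signed alphabet; this is the link between
    q and the coefficients c. *)
Lemma mpoly_superization (K : idomainType) (emb : {rmorphism rat -> K}) n
    (q : {mpoly rat[n]}) (f : series) (I : finType) (c : I -> rat)
    (ps : I -> seq nat)
    (fq : forall N, f N = q \mPo [tuple psum i.+1 N | i < n])
    (fc : forall N, f N = \sum_i c i *: \prod_(a <- ps i) psum a N)
    (w : seq (bool * K)) :
  mmap emb (fun i : 'I_n => signed_psum i.+1 w) q =
  psum_value emb c ps (fun a => signed_psum a w).
Proof.
elim/signed_word_ind: w => [xs|w1 w2 x IHw].
  rewrite -(eval_series_psum_value emb xs fc) /eval_series fq /comp_mpoly.
  rewrite mmap_mmap; apply: eq_mmap => i; rewrite tnth_mktuple.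
  rewrite -[RHS]/(eval_series emb (psum i.+1) xs).
  by rewrite eval_psum /signed_psum big_map.
pose embP : {rmorphism rat -> {poly K}} := polyC \o emb.
have hornerq z (v : 'I_n -> {poly K}) :
    (mmap embP v q).[z] = mmap emb (fun i => (v i).[z]) q.
  rewrite -[LHS]/(horner_eval z _) /mmap rmorph_sum; apply: eq_bigr => m _ /=.
  rewrite /horner_eval hornerM hornerC; congr (_ * _).
  by rewrite /mmap1 horner_prod; apply: eq_bigr => i _; rewrite horner_exp.
have HG : mmap embP (fun i : 'I_n => psum_poly w1 w2 x i.+1) q =
    \sum_i (emb (c i))%:P * \prod_(a <- ps i) psum_poly w1 w2 x a.
  apply: (poly_eq_on_nat emb) => m; rewrite hornerq horner_psum_value.
  transitivity (mmap emb
      (fun i : 'I_n => signed_psum i.+1 (w1 ++ nseq m (false, x) ++ w2)) q).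
    by apply: eq_mmap => i; rewrite psum_poly_nat.
  by rewrite IHw; apply: eq_psum_value => i a _; rewrite psum_poly_nat.
transitivity ((mmap embP (fun i : 'I_n => psum_poly w1 w2 x i.+1) q).[-1]).
  by rewrite hornerq; apply: eq_mmap => i; rewrite psum_poly_neg1.
rewrite HG horner_psum_value; apply: eq_psum_value => i a _.
exact: psum_poly_neg1.
Qed.

(** * Existence of the plethysm f[k(1 - alpha)] *)

Lemma eval_seriesE (L : comNzRingType) (emb : {rmorphism rat -> L})
    (f : series) N (xs : seq L) :
  size xs = N -> eval_series emb f xs = mmap emb (fun i : 'I_N => xs`_i) (f N).
Proof. by move=> <-. Qed.

Lemma eval_series_perm (L : comNzRingType) (emb : {rmorphism rat -> L})
    (f : series) (xs ys : seq L) :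
  symfun f -> perm_eq xs ys -> eval_series emb f xs = eval_series emb f ys.
Proof.
case=> f_sym _ _ xy; have /tuple_permP[s xsE] : perm_eq xs (in_tuple ys) by [].
rewrite (eval_seriesE _ _ (perm_size xy)) /eval_series.
have /issymP/(_ s) fs := f_sym (size ys); rewrite -[in RHS]fs.
rewrite mmap_mmap; apply: eq_mmap => i.
by rewrite mmapX mmap1U xsE -tnth_nth tnth_mktuple (tnth_nth 0).
Qed.

Lemma eval_series_rcons0 (L : comNzRingType) (emb : {rmorphism rat -> L})
    (f : series) (xs : seq L) :
  symfun f -> eval_series emb f (rcons xs 0) = eval_series emb f xs.
Proof.
case=> _ f_stable _; rewrite (eval_seriesE _ _ (size_rcons _ _)).
rewrite /eval_series -[in RHS]f_stable.
rewrite mmap_mmap; apply: eq_mmap => i.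
rewrite tnth_mktuple nth_rcons; case: unliftP => [j|] ->.
  by rewrite lift_max ltn_ord mmapX mmap1U.
by rewrite ltnn eqxx mmap0.
Qed.

Lemma eval_series_mid0 (L : comNzRingType) (emb : {rmorphism rat -> L})
    (f : series) (xs ys : seq L) :
  symfun f ->
  eval_series emb f (rcons xs 0 ++ ys) = eval_series emb f (xs ++ ys).
Proof.
move=> fS; rewrite -(eval_series_rcons0 _ (xs ++ ys)) //.
apply: eval_series_perm => //.
by rewrite -!cats1 -!catA perm_cat2l perm_catC.
Qed.

(** Iterated differences, where each entry of ys is compared with 0 at its own
    place at the end of the alphabet. *)
Fixpoint fdiff (L : comNzRingType) (F : seq L -> L) (ys xs : seq L) : L :=
  if ys is y :: ys' then fdiff F ys' (rcons xs y) - fdiff F ys' (rcons xs 0)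
  else F xs.

Lemma fdiff_ext (L : comNzRingType) (F G : seq L -> L) ys xs xs' :
  (forall zs, size zs = size ys -> F (xs ++ zs) = G (xs' ++ zs)) ->
  fdiff F ys xs = fdiff G ys xs'.
Proof.
elim: ys xs xs' => [|y ys IHys] xs xs' eqFG /=.
  by have := eqFG [::] erefl; rewrite !cats0.
by congr (_ - _); apply: IHys => zs zsE; rewrite !cat_rcons eqFG //= zsE.
Qed.

Lemma fdiff_sum (L : comNzRingType) (T : Type) (s : seq T)
    (F : T -> seq L -> L) ys xs :
  fdiff (fun zs => \sum_(m <- s) F m zs) ys xs =
  \sum_(m <- s) fdiff (F m) ys xs.
Proof.
by elim: ys xs => //= y ys IHys xs; rewrite !IHys -sumrB.
Qed.

Lemma fdiff_eq0 (L : comNzRingType) (F : seq L -> L) i ys xs :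
  (size xs <= i < size xs + size ys)%N ->
  (forall zs zs' : seq L, (forall j, j != i -> zs`_j = zs'`_j) ->
     F zs = F zs') ->
  fdiff F ys xs = 0.
Proof.
move=> iP F_i; elim: ys xs iP => [|y ys IHys] xs /=; first lia.
rewrite leq_eqVlt => /andP[/orP[/eqP xs_i|lt_i] i_lt]; last first.
  by rewrite !IHys ?subrr // !size_rcons; lia.
apply/eqP; rewrite subr_eq0; apply/eqP.
apply: fdiff_ext => zs _; apply: F_i; move=> j.
rewrite !nth_cat !size_rcons !nth_rcons xs_i ltnS => ji.
by rewrite leq_eqVlt (negbTE ji) /=; case: (j < i)%N.
Qed.

(** A monomial of degree less than the length of ys omits one of these
    variables, and the difference in that variable kills it. *)
Lemma fdiff_eval_series_eq0 (L : comNzRingType) (emb : {rmorphism rat -> L})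
    (f : series) d (xs ys : seq L) :
  (forall N, (msize (f N) <= d)%N) -> size ys = d ->
  fdiff (eval_series emb f) ys xs = 0.
Proof.
move=> f_d ys_d; set N := (size xs + size ys)%N.
pose F m (zs : seq L) : L :=
  emb (f N)@_m * mmap1 (fun i : 'I_N => zs`_i) m.
rewrite (fdiff_ext (G := fun zs => \sum_(m <- msupp (f N)) F m zs) (xs' := xs));
  last first.
  by move=> zs zsE; rewrite (@eval_seriesE _ _ _ N) // size_cat zsE.
rewrite fdiff_sum big_seq big1 // => m /msize_mdeg_lt m_d.
have /existsP[i /andP[iP /eqP mi0]] :
    [exists i : 'I_N, (size xs <= i)%N && (m i == 0)%N].
  apply: contraT => /existsPn mpos.
  suff : (d <= mdeg m)%N by have := leq_trans m_d (f_d N); lia.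
  rewrite mdegE (bigID (fun i : 'I_N => size xs <= i)%N) /=.
  apply: leq_trans (leq_addr _ _).
  apply: (@leq_trans (\sum_(i < N | (size xs <= i)%N) 1)); last first.
    by apply: leq_sum => i iP; move: (mpos i); rewrite iP lt0n.
  rewrite /N big_split_ord /= big_pred0 ?add0n; last first.
    by move=> i; rewrite leqNgt ltn_ord.
  under eq_bigl => i do rewrite leq_addr.
  by rewrite sum1_card card_ord ys_d.
apply: (@fdiff_eq0 _ _ i) => [|zs zs' eqz]; first by rewrite iP ltn_ord.
congr (_ * _); apply: eq_bigr => j _.
have [->|ji] := eqVneq j i; first by rewrite mi0 !expr0.
by rewrite eqz.
Qed.

(** By symmetry and stability, comparing a letter x with 0 amounts to comparing
    m + 1 with m copies of x. So differences in m of high order vanish, and a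
    polynomial is recovered by summing them back. *)
Lemma eval_series_nseq_poly (L : comNzRingType) (emb : {rmorphism rat -> L})
    (f : series) (xs : seq L) (x : L) :
  symfun f ->
  exists H : {poly L}, forall m : nat,
    H.[m%:R] = eval_series emb f (xs ++ nseq m x).
Proof.
move=> fS; have [_ _ [d f_d]] := fS.
(* g s is the difference of order s of the function g 0 to be interpolated. *)
pose g s m := fdiff (eval_series emb f) (nseq s x) (xs ++ nseq m x).
suff gP s r : (s + r = d)%N -> exists H : {poly L}, forall m, H.[m%:R] = g s m.
  exact: (gP 0 d).
elim: r s => [|r IHr] s sr.
  exists 0 => m; rewrite horner0 /g (fdiff_eval_series_eq0 _ _ f_d) //.
  by rewrite size_nseq -sr addn0.
have [P PE] := IHr s.+1 (etrans (addSnnS s r) sr).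
have [H [H0 HD]] := poly_antidifference emb P (g s 0).
exists H; elim=> [//|m IHm]; rewrite -natr1 HD IHm PE /g /=.
rewrite addrC -cats1 -catA -[[:: x]]/(nseq 1 x) -nseqD addn1.
rewrite (@fdiff_ext _ _ (eval_series emb f) _ (rcons _ 0) (xs ++ nseq m x)).
  by rewrite subrK.
by move=> zs _; apply: eval_series_mid0.
Qed.

(** The interpolating polynomial of m |-> f(1^k, alpha^m) is unique, hence
    compatible with the ring operations. On p_i it is k + m alpha^i, with value
    k (1 - alpha^i) at m = -k. *)
Lemma plethysm_exists (k : nat) :
  exists phi, is_plethysm (k%:~R * (1 - 'X)) phi.
Proof.
pose L : comNzRingType := {poly rat}; pose emb : {rmorphism rat -> L} := polyC.
pose ev f m := eval_series emb f (nseq k (1 : L) ++ nseq m ('X : L)).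
pose interp f : {poly L} :=
  epsilon (inhabits 0) (fun H : {poly L} => forall m : nat, H.[m%:R] = ev f m).
have interpE f (H : {poly L}) : (forall m, H.[m%:R] = ev f m) -> interp f = H.
  move=> HE; apply: (poly_eq_on_nat emb) => m; rewrite HE.
  apply: (epsilon_spec (inhabits 0)
    (fun H : {poly L} => forall m : nat, H.[m%:R] = ev f m)).
  by exists H.
have interpP f : symfun f -> forall m : nat, (interp f).[m%:R] = ev f m.
  move=> /(eval_series_nseq_poly emb (nseq k (1 : L)) ('X : L))[H HE] m.
  by rewrite (interpE f H).
exists (fun f => (interp f).[- k%:R]); split.
- rewrite (interpE _ 1) ?hornerC // => m.
  by rewrite hornerC /ev /eval_series rmorph1.
- move=> f g fS gS; rewrite (interpE _ (interp f + interp g)) ?hornerD // => m.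
  by rewrite hornerD !interpP // /ev /eval_series rmorphD.
- move=> f g fS gS; rewrite (interpE _ (interp f * interp g)) ?hornerM // => m.
  by rewrite hornerM !interpP // /ev /eval_series rmorphM.
- move=> r f fS; rewrite (interpE _ ((r%:P : L) *: interp f)).
    by rewrite hornerZ mul_polyC.
  by move=> m; rewrite hornerZ !interpP // /ev /eval_series mmapZ.
move=> i i_gt0; rewrite (interpE _ ((k%:R : L)%:P + ('X^i : L) *: 'X)).
  rewrite hornerD hornerC hornerZ hornerX rmorphM rmorphB /= rmorph_nat rmorph1.
  rewrite comp_polyX; ring.
move=> m; rewrite hornerD hornerC hornerZ hornerX /ev eval_psum big_cat /=.
by rewrite !big_nseq -!Monoid.iteropE expr1n mulr_natr.
Qed.

(** * Values of plethysms on power sums *)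

Lemma symfun_const (c : rat) : symfun (fun N => c%:MP).
Proof.
split=> [N|N|]; first by apply/issymP => s; apply: mmapC.
  exact: comp_mpolyC.
by exists 1%N => N; rewrite msizeC; case: eqP.
Qed.

Lemma symfunD f g : symfun f -> symfun g -> symfun (fun N => f N + g N).
Proof.
case=> [fS fD [df fd]] [gS gD [dg gd]]; split=> [N|N|].
  by apply/issymP => s; rewrite rmorphD /= (issymP _ (fS N)) (issymP _ (gS N)).
  by rewrite -[in RHS]fD -[in RHS]gD /drop_last_var rmorphD.
exists (maxn df dg) => N; apply: leq_trans (msizeD_le _ _) _.
by rewrite geq_max !leq_max fd gd orbT.
Qed.

Lemma symfunM f g : symfun f -> symfun g -> symfun (fun N => f N * g N).
Proof.
case=> [fS fD [df fd]] [gS gD [dg gd]]; split=> [N|N|].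
  by apply/issymP => s; rewrite msymM (issymP _ (fS N)) (issymP _ (gS N)).
  by rewrite -[in RHS]fD -[in RHS]gD /drop_last_var rmorphM.
exists (df + dg).+1%N => N; apply: leq_trans (msizeM_le _ _) _.
by rewrite ltnS leq_add.
Qed.

Lemma symfunZ r f : symfun f -> symfun (fun N => r *: f N).
Proof.
case=> [fS fD [df fd]]; split=> [N|N|].
  by apply/issymP => s; rewrite msymZ (issymP _ (fS N)).
  by rewrite -[in RHS]fD /drop_last_var comp_mpolyZ.
by exists df => N; apply: leq_trans (msizeZ_le _ _) _.
Qed.

Lemma symfun_psum i : (0 < i)%N -> symfun (psum i).
Proof.
move=> i_gt0; split=> [N|N|].
- apply/issymP => s; rewrite /psum rmorph_sum /=.
  rewrite [RHS](reindex_inj (@perm_inj _ s)).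
  by apply: eq_bigr => j _; rewrite rmorphXn /= /msym mmapX mmap1U.
- rewrite /drop_last_var /psum rmorph_sum /= big_ord_recr /=.
  rewrite rmorphXn /= comp_mpolyXU -tnth_nth tnth_mktuple unlift_none.
  rewrite expr0n eqn0Ngt i_gt0 addr0; apply: eq_bigr => j _.
  rewrite rmorphXn /= comp_mpolyXU -tnth_nth tnth_mktuple.
  rewrite (_ : widen_ord _ j = lift ord_max j) ?liftK //.
  exact/val_inj/esym/(lift_max j).
exists i.+1 => N; apply: leq_trans (msize_sum _ _ _) _.
apply/bigmax_leqP => j _; rewrite mpolyXn msizeX mdegMn mdeg1.
by rewrite mul1n.
Qed.

Lemma plethysm_prod_psum a phi (r : seq nat) :
  is_plethysm a phi -> all (leq 1) r ->
  symfun (fun N => \prod_(i <- r) psum i N) /\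
  phi (fun N => \prod_(i <- r) psum i N) = \prod_(i <- r) (a \Po 'X^i).
Proof.
move=> phiP; elim: r => [_|i r IHr /= /andP[i_gt0 r_gt0]].
  have -> : (fun N => \prod_(i <- [::]) psum i N) = (fun N => 1%:MP).
    by apply: functional_extensionality_dep => N; rewrite big_nil.
  by split; [exact: symfun_const | rewrite big_nil (plethysm1 phiP)].
have [rS rE] := IHr r_gt0; have iS := symfun_psum i_gt0.
have -> : (fun N => \prod_(i <- i :: r) psum i N) =
    (fun N => psum i N * \prod_(i <- r) psum i N).
  by apply: functional_extensionality_dep => N; rewrite big_cons.
split; first exact: symfunM.
by rewrite (plethysmM phiP) // rE (plethysm_psum phiP) // big_cons.
Qed.

Lemma plethysm_lincomb a phi (I : Type) (r : seq I) (c : I -> rat)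
    (F : I -> series) :
  is_plethysm a phi -> (forall i, symfun (F i)) ->
  symfun (fun N => \sum_(i <- r) c i *: F i N) /\
  phi (fun N => \sum_(i <- r) c i *: F i N) = \sum_(i <- r) c i *: phi (F i).
Proof.
move=> phiP FS; elim: r => [|i r [rS rE]].
  have -> : (fun N => \sum_(i <- [::]) c i *: F i N) =
      (fun N => 0 *: 1%:MP : {mpoly rat[N]}).
    by apply: functional_extensionality_dep => N; rewrite big_nil scale0r.
  have S1 := symfun_const 1; split; first exact: symfunZ.
  by rewrite big_nil (plethysmZ phiP) // scale0r.
have -> : (fun N => \sum_(i <- i :: r) c i *: F i N) =
    (fun N => c i *: F i N + \sum_(i <- r) c i *: F i N).
  by apply: functional_extensionality_dep => N; rewrite big_cons.
have iS := symfunZ (c i) (FS i); split; first exact: symfunD.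
by rewrite (plethysmD phiP) // rE (plethysmZ phiP) // big_cons.
Qed.

Lemma Theta_psums (K : fieldType) (emb : {rmorphism rat -> K}) (y : K)
    (k : nat) (f : series) (I : finType) (c : I -> rat) (ps : I -> seq nat) :
  (forall i, all (leq 1) (ps i)) ->
  (forall N, f N = \sum_i c i *: \prod_(a <- ps i) psum a N) ->
  Theta y k f =
  psum_value emb c ps (fun a => k%:R * (1 - (- y) ^+ a)).
Proof.
move=> ps_gt0 fE; rewrite /Theta.
have phiP : is_plethysm (k%:~R * (1 - 'X)) (plethysm (k%:~R * (1 - 'X))).
  exact: epsilon_spec (plethysm_exists k).
have -> : f = (fun N => \sum_i c i *: \prod_(a <- ps i) psum a N).
  exact: functional_extensionality_dep.
have psP i := plethysm_prod_psum phiP (ps_gt0 i).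
have [_ ->] := plethysm_lincomb (index_enum I) c phiP (fun i => (psP i).1).
rewrite (eq_map_poly (fun r => esym (fmorph_eq_rat emb r))).
rewrite rmorph_sum horner_sum; apply: eq_bigr => i _ /=.
rewrite map_polyZ hornerZ (psP i).2 rmorph_prod horner_prod.
congr (_ * _); apply: eq_bigr => a _.
rewrite rmorphM rmorphB /= rmorph_nat rmorph1 comp_polyX.
rewrite rmorphM rmorphB /= rmorph_nat rmorph1.
by rewrite map_polyXn !(hornerE, hornerMn, hornerXn).
Qed.

(** * Rational generating functions *)

Definition conv (K : nzRingType) (p : {poly K}) (s : nat -> K) (m : nat) : K :=
  \sum_(i < m.+1) p`_i * s (m - i)%N.

Lemma convE (K : nzRingType) (p : {poly K}) s M m :
  (m < M)%N -> conv p s m = (p * \poly_(i < M) s i)`_m.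
Proof.
move=> mM; rewrite coefM; apply: eq_bigr => i _; rewrite coef_poly.
by rewrite (leq_ltn_trans (leq_subr _ _) mM).
Qed.

Lemma conv_coef (K : nzRingType) (p q : {poly K}) m :
  conv p (fun i => q`_i) m = (p * q)`_m.
Proof. by rewrite coefM. Qed.

Lemma eq_conv (K : nzRingType) (p : {poly K}) s s' :
  s =1 s' -> conv p s =1 conv p s'.
Proof. by move=> eqs m; apply: eq_bigr => i _; rewrite eqs. Qed.

Lemma convM (K : nzRingType) (p q : {poly K}) s :
  conv (p * q) s =1 conv p (conv q s).
Proof.
move=> m; rewrite (convE _ _ (ltnSn m)) -mulrA coefM; apply: eq_bigr => i _.
by rewrite -convE // ltnS leq_subr.
Qed.

Lemma conv_affine (K : nzRingType) (a b : K) s m :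
  conv (a%:P + b *: 'X) s m = a * s m + b * (if m is k.+1 then s k else 0).
Proof.
rewrite /conv big_ord_recl !coefE /= mulr0 addr0 subn0; congr (_ + _).
case: m => [|m]; first by rewrite big_ord0 mulr0.
rewrite big_ord_recl !coefE /= mulr1 add0r subSS subn0 big1 ?addr0 // => i _.
by rewrite !coefE /= mulr0 add0r mul0r.
Qed.

Lemma eq_expands (K : fieldType) (r r' : {fraction {poly K}}) s s' :
  r = r' -> s =1 s' -> expands r s -> expands r' s'.
Proof.
move=> <- eqs [num [den [d0 rE sE]]]; exists num, den; split=> // m.
by rewrite -sE; apply: eq_bigr => i _; rewrite eqs.
Qed.

Lemma tofrac_coef0_neq0 (K : fieldType) (p : {poly K}) :
  p`_0 != 0 -> tofrac p != 0.
Proof.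
by apply: contraNneq => /eqP; rewrite tofrac_eq0 => /eqP ->; rewrite coef0.
Qed.

(** A linear recurrence with constant coefficients relating two sequences is a
    rational factor between their generating functions. *)
Lemma expands_recurrence (K : fieldType) (r : {fraction {poly K}}) s s'
    (a b : {poly K}) :
  a`_0 != 0 -> conv a s' =1 conv b s -> expands r s ->
  expands (tofrac b / tofrac a * r) s'.
Proof.
move=> a0 rec [num [den [d0 -> sE]]]; exists (b * num), (den * a); split.
- by rewrite coef0M mulf_neq0.
- by rewrite !rmorphM /= invfM mulrACA [X in _ * X]mulrC.
move=> m; rewrite -[LHS]/(conv _ _ _) convM (eq_conv _ rec) -convM mulrC convM.
rewrite -conv_coef; apply: eq_conv => i; exact: sE.
Qed.

Lemma expandsZ (K : fieldType) (c : K) (r : {fraction {poly K}}) s :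
  expands r s -> expands (tofrac c%:P * r) (fun m => c * s m).
Proof.
move=> rs; have := @expands_recurrence K r s (fun m => c * s m) 1 c%:P.
rewrite coef1 rmorph1 divr1; apply=> //; first exact: oner_neq0.
move=> m; have := conv_affine c 0 s m.
have := conv_affine 1 0 (fun m => c * s m) m.
by rewrite !scale0r !addr0 !mul0r !addr0 mul1r => -> ->.
Qed.

Lemma expandsD (K : fieldType) (r1 r2 : {fraction {poly K}}) s1 s2 :
  expands r1 s1 -> expands r2 s2 -> expands (r1 + r2) (fun m => s1 m + s2 m).
Proof.
move=> [n1 [d1 [d10 -> s1E]]] [n2 [d2 [d20 -> s2E]]].
exists (n1 * d2 + n2 * d1), (d1 * d2); split.
- by rewrite coef0M mulf_neq0.
- by rewrite !rmorphD !rmorphM /= addf_div // tofrac_coef0_neq0.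
move=> m; have -> : \sum_(i < m.+1) (d1 * d2)`_i * (s1 (m - i)%N + s2 (m - i)%N)
    = conv (d1 * d2) s1 m + conv (d1 * d2) s2 m.
  by rewrite -big_split; apply: eq_bigr => i _; rewrite mulrDr.
rewrite {1}[d1 * d2]mulrC !convM coefD; congr (_ + _).
  by rewrite mulrC -conv_coef; apply: eq_conv => i; exact: s1E.
by rewrite mulrC -conv_coef; apply: eq_conv => i; exact: s2E.
Qed.

Lemma expands0 (K : fieldType) : expands (0 : {fraction {poly K}}) (fun=> 0).
Proof.
exists 0, 1; split; first by rewrite coef1 oner_neq0.
  by rewrite rmorph0 mul0r.
by move=> m; rewrite coef0 big1 // => i _; rewrite mulr0.
Qed.

Lemma expands_sum (K : fieldType) (I : Type) (l : seq I) (P : pred I)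
    (r : I -> {fraction {poly K}}) (s : I -> nat -> K) :
  (forall i, P i -> expands (r i) (s i)) ->
  expands (\sum_(i <- l | P i) r i) (fun m => \sum_(i <- l | P i) s i m).
Proof.
move=> rs; elim: l => [|i l IHl].
  apply: eq_expands (@expands0 K); first by rewrite big_nil.
  by move=> m; rewrite big_nil.
case Pi: (P i); last first.
  apply: eq_expands IHl; first by rewrite big_cons Pi.
  by move=> m; rewrite big_cons Pi.
apply: eq_expands (expandsD (rs i Pi) IHl); first by rewrite big_cons Pi.
by move=> m; rewrite big_cons Pi.
Qed.

Lemma expands_geometric (K : fieldType) : expands (1 / (1 - tvar K)) (fun=> 1).
Proof.
exists 1, (1 - 'X); split.
- by rewrite !coefE subr0 oner_neq0.
- by rewrite rmorphB !rmorph1.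
move=> m; have := conv_affine 1 (-1) (fun=> 1 : K) m.
rewrite scaleN1r polyC1 /conv => ->; rewrite coef1.
by case: m => [|m]; rewrite ?mulr0 ?addr0 ?mulr1 ?subrr.
Qed.

Lemma expands_step (K : fieldType) (p0 p1 : K) (r : {fraction {poly K}}) s s' :
  s' 0 = p0 * s 0 -> (forall k, s' k.+1 = s' k + p0 * s k.+1 + p1 * s k) ->
  expands r s ->
  expands ((tofrac p0%:P + tofrac p1%:P * tvar K) / (1 - tvar K) * r) s'.
Proof.
move=> s'0 s'S.
have -> : 1 - tvar K = tofrac (1 - 'X) by rewrite rmorphB rmorph1.
have -> : tofrac p0%:P + tofrac p1%:P * tvar K = tofrac (p0%:P + p1 *: 'X).
  by rewrite -mul_polyC rmorphD rmorphM.
apply: expands_recurrence => [|m]; first by rewrite !coefE subr0 oner_neq0.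
have := conv_affine 1 (-1) s' m; rewrite scaleN1r polyC1 => ->.
rewrite conv_affine; case: m => [|m]; first by rewrite s'0; ring.
rewrite s'S; ring.
Qed.

(** * Peaks and descents as rational factors *)

(** The negative letter comes first in each block. In this order, the descent
    statistics that come out are the interior peaks, rather than the peaks of
    the word framed by smaller letters. *)
Definition superblocks (K : nzRingType) (y : K) (k : nat) : seq (bool * K) :=
  flatten (nseq k [:: (true, - y); (false, 1)]).

Lemma actword_superblocksS (K : comNzRingType) D (y : K) k S :
  actword D (superblocks y k.+1) S =
  addletter D 1 (remletter D (- y) (actword D (superblocks y k) S)).
Proof.
rewrite /superblocks -addn1 nseqD flatten_cat actword_cat /=.
by [].
Qed.

Lemma actword0 (K : comNzRingType) D (w : seq (bool * K)) S :
  actword D w S 0 = S 0.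
Proof. by elim: w S => //= -[[] x] w IHw S; rewrite IHw. Qed.

(** With S k the state after k blocks and V k the state after the negative
    letter of the next block, a descent step expresses the next entries of both
    through the current entry of V alone. *)
Lemma expands_descent (K : fieldType) (D : pred nat) (y : K) j
    (r : {fraction {poly K}}) :
  let S k := actword D (superblocks y k) (@emptyvec K) in
  let V k := remletter D (- y) (S k) in
  let t := tvar K in let Y := tofrac y%:P in
  D j -> expands r (V^~ j) ->
  expands (t * (1 + Y) / (1 - t) * r) (S^~ j.+1) /\
  expands ((t + Y) / (1 - t) * r) (V^~ j.+1).
Proof.
move=> S V t Y Dj rV.
have VS k : V k j.+1 = S k j.+1 + y * V k j by rewrite /V /= Dj; ring.
have SS k : S k.+1 j.+1 = V k j.+1 + V k j.
  by rewrite {1}/S actword_superblocksS -/(V k) /= Dj mul1r.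
have S0 : S 0 j.+1 = 0 by [].
split.
  have := @expands_step K 0 (1 + y) r (V^~ j) (S^~ j.+1).
  rewrite rmorph0 add0r !rmorphD /= rmorph1 [_ * t]mulrC; apply => //.
    by rewrite S0 mul0r.
  by move=> k; rewrite SS VS /=; ring.
have := @expands_step K y 1 r (V^~ j) (V^~ j.+1).
rewrite rmorph1 mul1r [_ + t]addrC; apply=> //.
  by rewrite VS S0 add0r.
by move=> k; rewrite [LHS]VS SS /=; ring.
Qed.

(** An ascent step depends on the current entry of S alone. The entry j + 1
    rather than j matters: S 0 must vanish there. *)
Lemma expands_ascent (K : fieldType) (D : pred nat) (y : K) j
    (r : {fraction {poly K}}) :
  let S k := actword D (superblocks y k) (@emptyvec K) in
  let V k := remletter D (- y) (S k) in
  let t := tvar K in let Y := tofrac y%:P in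
  ~~ D j.+1 -> expands r (S^~ j.+1) ->
  expands ((1 + Y * t) / (1 - t) * r) (S^~ j.+2) /\
  expands ((1 + Y) / (1 - t) * r) (V^~ j.+2).
Proof.
move=> S V t Y /negbTE Dj rS.
have VS k : V k j.+2 = S k j.+2 + y * S k j.+1 by rewrite /V /= Dj; ring.
have SS k : S k.+1 j.+2 = V k j.+2 + S k.+1 j.+1.
  rewrite {1}/S actword_superblocksS -/(V k) /= Dj mul1r.
  by rewrite /S actword_superblocksS.
have S0 i : S 0 i.+1 = 0 by [].
split.
  have := @expands_step K 1 y r (S^~ j.+1) (S^~ j.+2).
  rewrite rmorph1; apply => //; first by rewrite !S0 mulr0.
  by move=> k; rewrite SS VS /=; ring.
have := @expands_step K (1 + y) 0 r (S^~ j.+1) (V^~ j.+2).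
rewrite rmorph0 mul0r addr0 !rmorphD /= !rmorph1; apply=> //.
  by rewrite VS !S0; ring.
by move=> k; rewrite [LHS]VS SS /=; ring.
Qed.

Definition des_count (D : pred nat) (j : nat) : nat := \sum_(i < j) D i.+1.
Definition pk_count (D : pred nat) (j : nat) : nat :=
  \sum_(i < j) (D i.+1 && ~~ D i).

Definition pkdes_gf (F : fieldType) (Y t : F) (n p d : nat) : F :=
  1 / (1 + Y) * ((1 + Y * t) / (1 - t)) ^+ n.+1 *
    (((1 + Y) ^+ 2 * t / ((Y + t) * (1 + Y * t))) ^+ p.+1 *
     ((Y + t) / (1 + Y * t)) ^+ d.+1).

Lemma pkdes_gf1 (F : fieldType) (Y t : F) :
  1 + Y != 0 -> 1 - t != 0 -> Y + t != 0 -> 1 + Y * t != 0 ->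
  pkdes_gf Y t 1 0 0 = t * (1 + Y) / (1 - t) * (1 / (1 - t)).
Proof.
move=> Y1 t1 Yt Yt1; rewrite /pkdes_gf !expr1; field.
by rewrite Y1 t1 Yt Yt1.
Qed.

Lemma pkdes_gf_ascent (F : fieldType) (Y t : F) n p d :
  pkdes_gf Y t n.+1 p d = (1 + Y * t) / (1 - t) * pkdes_gf Y t n p d.
Proof. by rewrite /pkdes_gf [_ ^+ n.+2]exprS; ring. Qed.

Lemma pkdes_gf_peak (F : fieldType) (Y t : F) n p d :
  1 - t != 0 -> Y + t != 0 -> 1 + Y * t != 0 ->
  pkdes_gf Y t n.+1 p.+1 d.+1 =
  t * (1 + Y) / (1 - t) * ((1 + Y) / (1 + Y * t) * pkdes_gf Y t n p d).
Proof.
move=> t1 Yt Yt1; rewrite /pkdes_gf.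
rewrite [_ ^+ n.+2]exprS [_ ^+ p.+2]exprS [_ ^+ d.+2]exprS.
move: (_ ^+ n.+1) (_ ^+ p.+1) (_ ^+ d.+1) (1 / (1 + Y)) => A B C E.
by field; rewrite t1 Yt Yt1.
Qed.

Lemma pkdes_gf_descent (F : fieldType) (Y t : F) n p d :
  1 + Y != 0 -> 1 - t != 0 -> t != 0 -> 1 + Y * t != 0 ->
  pkdes_gf Y t n.+1 p d.+1 =
  t * (1 + Y) / (1 - t) * ((t + Y) / (t * (1 + Y)) * pkdes_gf Y t n p d).
Proof.
move=> Y1 t1 t0 Yt1; rewrite /pkdes_gf.
rewrite [_ ^+ n.+2]exprS [_ ^+ d.+2]exprS.
move: (_ ^+ n.+1) (_ ^+ p.+1) (_ ^+ d.+1) => A B C.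
by field; rewrite Y1 t1 t0 Yt1.
Qed.

(** The ratio of the generating functions of V and S depends on the last step
    only: (t+Y)/(t(1+Y)) after a descent and (1+Y)/(1+Yt) after an ascent. The
    factor of a descent step is therefore different at a peak, where the step
    before is an ascent. *)
Lemma expands_superblocks (K : fieldType) (D : pred nat) (y : K) j :
  1 + y != 0 -> D 0 ->
  expands (pkdes_gf (tofrac y%:P) (tvar K) j.+1 (pk_count D j) (des_count D j))
    (fun k => actword D (superblocks y k) (@emptyvec K) j.+1).
Proof.
move=> y1 D0; set Y := tofrac y%:P; set t := tvar K.
pose S k := actword D (superblocks y k) (@emptyvec K).
pose V k := remletter D (- y) (S k).
have Y1 : 1 + Y != 0.
  rewrite -(rmorph1 (@tofrac _)) -polyC1 -rmorphD -polyCD.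
  by rewrite tofrac_eq0 polyC_eq0.
have t0 : t != 0 by rewrite tofrac_eq0 polyX_eq0.
have t1 : 1 - t != 0.
  rewrite -(rmorph1 (@tofrac _)) -rmorphB; apply: tofrac_coef0_neq0.
  by rewrite !coefE subr0 oner_neq0.
have Yt : Y + t != 0.
  rewrite -rmorphD tofrac_eq0; apply/negP => /eqP.
  move=> /(congr1 (fun p : {poly K} => p`_1)).
  by rewrite !coefE add0r => /eqP; rewrite oner_eq0.
have Yt1 : 1 + Y * t != 0.
  rewrite -(rmorph1 (@tofrac _)) -rmorphM -rmorphD; apply: tofrac_coef0_neq0.
  by rewrite mul_polyC !coefE mulr0 addr0 oner_neq0.
pose R j := pkdes_gf Y t j.+1 (pk_count D j) (des_count D j).
suff [] : expands (R j) (S^~ j.+1) /\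
  expands ((if D j then (t + Y) / (t * (1 + Y)) else (1 + Y) / (1 + Y * t)) *
    R j) (V^~ j.+1) by [].
have ratioV c v : c != 0 ->
    (t + Y) / (1 - t) * v = (t + Y) / c * (c / (1 - t) * v).
  by move=> c0; rewrite [RHS]mulrA [_ / c * _]mulrA divfK.
have tY : t * (1 + Y) != 0 := mulf_neq0 t0 Y1.
elim: j => [|j [IHS IHV]].
  have rV : expands (1 / (1 - t)) (V^~ 0).
    apply: eq_expands (expands_geometric K) => // k.
    by rewrite /V /= /S actword0.
  have [rS rV1] := expands_descent D0 rV.
  rewrite D0 /R /des_count /pk_count !big_ord0.
  rewrite (pkdes_gf1 Y1 t1 Yt Yt1) -(ratioV _ _ tY); split; first exact: rS.
  exact: rV1.
case Dj: (D j.+1).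
  have [rS rV] := expands_descent Dj IHV.
  suff -> : R j.+1 = t * (1 + Y) / (1 - t) *
      ((if D j then (t + Y) / (t * (1 + Y)) else (1 + Y) / (1 + Y * t)) * R j).
    by rewrite -(ratioV _ _ tY); split; [exact: rS | exact: rV].
  rewrite /R /pk_count /des_count !big_ord_recr /= Dj addn1.
  case: (D j); rewrite ?addn0 ?addn1.
    exact: pkdes_gf_descent Y1 t1 t0 Yt1.
  exact: pkdes_gf_peak t1 Yt Yt1.
have [rS rV] := expands_ascent (negbT Dj) IHS.
rewrite /R /pk_count /des_count !big_ord_recr /= Dj !addn0 pkdes_gf_ascent.
split; first exact: rS.
have -> : (1 + Y) / (1 + Y * t) * ((1 + Y * t) / (1 - t) * R j) =
    (1 + Y) / (1 - t) * R j.
  by rewrite mulrA [_ / (1 + Y * t) * _]mulrA (divfK Yt1).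
exact: rV.
Qed.

(** * Descents, peaks and stable sorting *)

Lemma is_des_last n (pi : 'S_n.+1) : is_des pi ord_max = false.
Proof.
apply/existsP => -[j /andP[/eqP jn _]].
by have := ltn_ord j; rewrite jn ltnn.
Qed.

Lemma is_peakE n (pi : 'S_n) (i : 'I_n) :
  is_peak pi i = steps pi i.+1 && ~~ steps pi i.
Proof.
rewrite stepsS; apply/existsP/andP => [[h /existsP[j]]|[]].
  case/and4P => /eqP ih ji hi pji; split.
    by apply/existsP; exists j; rewrite ji.
  rewrite ih stepsS; apply/existsP => -[k /andP[/eqP kh]].
  rewrite (_ : k = i); last by apply: val_inj; rewrite /= kh ih.
  by rewrite ltnNge ltnW.
move=> /existsP[j /andP[ji pji]]; case iE: (i : nat) => [|h] //.
have h_n : (h < n)%N by have := ltn_ord i; lia.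
rewrite (stepsS pi (Ordinal h_n)) => /existsPn/(_ i); rewrite /= iE eqxx /=.
rewrite -leqNgt leq_eqVlt => /orP[/eqP/val_inj/perm_inj hi|hi].
  by have := congr1 val hi; rewrite /= iE; lia.
exists (Ordinal h_n); apply/existsP; exists j.
by rewrite /= -iE ji pji hi eqxx.
Qed.

Lemma des_steps n (pi : 'S_n.+1) : des pi = des_count (steps pi) n.
Proof.
rewrite /des /des_count -sum1_card big_mkcond big_ord_recr inE is_des_last.
apply: etrans (addn0 _) _; apply: eq_bigr => i _.
rewrite -[i.+1]/(widen_ord (leqnSn n) i).+1 stepsS inE.
by case: is_des.
Qed.

Lemma pk_steps n (pi : 'S_n.+1) : pk pi = pk_count (steps pi) n.
Proof.
rewrite /pk /pk_count -sum1_card big_mkcond big_ord_recr.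
rewrite inE is_peakE stepsS is_des_last.
apply: etrans (addn0 _) _; apply: eq_bigr => i _.
rewrite -[i : nat]/(widen_ord (leqnSn n) i : nat) inE is_peakE.
by case: (_ && _).
Qed.

Lemma expands_pkdes (K : fieldType) (y : K) n (Pi : {set 'S_n}) :
  let t := tvar K in let Y := tofrac y%:P in
  1 + y != 0 -> (0 < n)%N ->
  expands (1 / (1 + Y) * ((1 + Y * t) / (1 - t)) ^+ n.+1 *
      Ppkdes Pi ((1 + Y) ^+ 2 * t / ((Y + t) * (1 + Y * t)))
                ((Y + t) / (1 + Y * t)))
    (fun k => \sum_(pi in Pi) actword (steps pi) (superblocks y k)
                                (@emptyvec K) n).
Proof.
case: n Pi => // n Pi t Y y1 _.
have -> : 1 / (1 + Y) * ((1 + Y * t) / (1 - t)) ^+ n.+2 *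
      Ppkdes Pi ((1 + Y) ^+ 2 * t / ((Y + t) * (1 + Y * t)))
                ((Y + t) / (1 + Y * t)) =
    \sum_(pi in Pi) pkdes_gf Y t n.+1 (pk pi) (des pi).
  by rewrite /Ppkdes mulr_sumr.
apply: expands_sum => pi _; rewrite des_steps pk_steps.
exact: expands_superblocks.
Qed.

(** The order in which stable sorting by the values of w lists the positions. *)
Definition stable_le n N (w : {ffun 'I_n -> 'I_N}) (a b : 'I_n) : bool :=
  (w a < w b)%N || (w a == w b) && (a <= b)%N.

Lemma nth_codom_ord n (T : Type) (x0 : T) (f : 'I_n -> T) (i : 'I_n) :
  nth x0 (codom f) i = f i.
Proof.
by rewrite /codom /image_mem (nth_map i) ?size_enum_ord ?nth_ord_enum.
Qed.

(** Equal values of w must appear with increasing positions: a descent of pi is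
    exactly where weak increase is not enough. *)
Lemma compatible_sorted n N (pi : 'S_n.+1) (w : {ffun 'I_n.+1 -> 'I_N}) :
  compatible pi [ffun j => w (pi j)] = sorted (stable_le w) (codom pi).
Proof.
have step (j j' : 'I_n.+1) : j' = j.+1 :> nat ->
    (if is_des pi j then w (pi j) < w (pi j') else w (pi j) <= w (pi j'))%N =
    stable_le w (pi j) (pi j').
  move=> jj'; have -> : is_des pi j = (pi j' < pi j)%N.
    apply/existsP/idP => [[k /andP[/eqP kj]]|lt_pi].
      by rewrite (_ : k = j') //; apply: val_inj; rewrite /= kj.
    by exists j'; rewrite jj' eqxx.
  have ne : pi j != pi j'.
    by rewrite (inj_eq perm_inj) -val_eqE /= jj' neq_ltn leqnn.
  by move: ne; rewrite /stable_le -!val_eqE /=; case: ltnP; lia.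
apply/forallP/(sortedP ord0) => [compat i|srt j].
  rewrite size_codom card_ord => i_n.
  have i_n' := ltnW i_n.
  rewrite (nth_codom_ord _ _ (Ordinal i_n')) (nth_codom_ord _ _ (Ordinal i_n)).
  move: (compat (Ordinal i_n')) => /forallP/(_ (Ordinal i_n)).
  by rewrite /= eqxx !ffunE step.
apply/forallP => j'; apply/implyP => /eqP jj'; rewrite !ffunE step //.
have := srt j; rewrite size_codom card_ord -jj' => /(_ (ltn_ord j')).
by rewrite !nth_codom_ord.
Qed.

Lemma stable_sort_unique n N (w : {ffun 'I_n.+1 -> 'I_N}) :
  exists pi0 : 'S_n.+1, forall pi : 'S_n.+1,
    compatible pi [ffun j => w (pi j)] = (pi == pi0).
Proof.
have tot : total (stable_le w).
  by move=> a b; rewrite /stable_le -!val_eqE /=; lia.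
have trans : transitive (stable_le w).
  by move=> b a c; rewrite /stable_le -!val_eqE /=; lia.
have anti : antisymmetric (stable_le w).
  move=> a b; rewrite /stable_le -!val_eqE /= => H; apply: val_inj => /=.
  lia.
have /tuple_permP[pi0 pi0E] : perm_eq (sort (stable_le w) (enum 'I_n.+1))
    (ord_tuple n.+1) by rewrite perm_sort.
have codom0 : codom pi0 = sort (stable_le w) (enum 'I_n.+1).
  rewrite pi0E; apply: eq_map => i; by rewrite tnth_ord_tuple.
exists pi0 => pi; rewrite compatible_sorted.
apply/idP/eqP => [srt|->]; last first.
  by rewrite codom0 sort_sorted.
have eqc : codom pi = codom pi0.
  apply: (sorted_eq trans anti srt); first by rewrite codom0 sort_sorted.
  rewrite codom0 perm_sym perm_sort; apply: uniq_perm.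
  - exact: enum_uniq.
  - by apply/injectiveP; apply: perm_inj.
  move=> i; rewrite mem_enum; apply/esym/codomP; exists (pi^-1%g i).
  by rewrite permKV.
apply/permP => j; have := congr1 (fun s => nth ord0 s j) eqc.
by rewrite !nth_codom_ord.
Qed.

(** Substituting the word w = i o pi^-1 for the sequence i makes the monomial
    independent of pi, and each w is counted for its stable sorting permutation
    only. *)
Lemma Qgf_all n N : Qgf [set: 'S_n.+1] N = (\sum_(j < N) 'X_j) ^+ n.+1.
Proof.
transitivity (\sum_(w : {ffun 'I_n.+1 -> 'I_N})
    \prod_(j < n.+1) 'X_(w j) : {mpoly rat[N]}); last first.
  by rewrite -(bigA_distr_bigA (fun _ j => 'X_j)) prodr_const card_ord.
rewrite /Qgf /Fqsym.
transitivity (\sum_(pi : 'S_n.+1) \sum_(w : {ffun 'I_n.+1 -> 'I_N} |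
    compatible pi [ffun j => w (pi j)])
    \prod_(j < n.+1) 'X_(w j) : {mpoly rat[N]}).
  apply: eq_big => [pi|pi _]; first by rewrite inE.
  rewrite (reindex (fun w : {ffun 'I_n.+1 -> 'I_N} => [ffun j => w (pi j)]))
    /=; last first.
    exists (fun w : {ffun 'I_n.+1 -> 'I_N} => [ffun j => w (pi^-1 j)%g]) => w _;
      by apply/ffunP => j; rewrite !ffunE (permK, permKV).
  apply: eq_bigr => w _; rewrite [RHS](reindex_inj (@perm_inj _ pi)) /=.
  by apply: eq_bigr => j _; rewrite ffunE.
rewrite (exchange_big_dep predT) //=; apply: eq_bigr => w _.
have [pi0 pi0P] := stable_sort_unique w.
by rewrite (big_pred1 pi0).
Qed.

(** * Eulerian polynomials *)

Lemma signed_psum_superblocks (L : comNzRingType) (y : L) k a :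
  signed_psum a (superblocks y k) = k%:R * (1 - (- y) ^+ a).
Proof.
elim: k => [|k IHk]; first by rewrite /signed_psum big_nil mul0r.
rewrite /signed_psum /superblocks !big_cons /= in IHk *.
by rewrite IHk expr1n -[k.+1%:R]natr1; ring.
Qed.

Definition eulerian_gf (F : fieldType) (t : F) (l : nat) : F :=
  eulerian l t / (1 - t) ^+ l.+1.

Lemma pkdes_at0 (F : fieldType) n (Pi : {set 'S_n}) (t : F) :
  t != 0 ->
  1 / (1 + 0) * ((1 + 0 * t) / (1 - t)) ^+ n.+1 *
    Ppkdes Pi ((1 + 0) ^+ 2 * t / ((0 + t) * (1 + 0 * t)))
              ((0 + t) / (1 + 0 * t)) =
  Ades Pi t / (1 - t) ^+ n.+1.
Proof.
move=> t0; rewrite !mul0r !addr0 !add0r expr1n !mul1r mulr1 !divr1 divff //.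
rewrite invr1 mul1r exprVn mulrC; congr (_ / _); apply: eq_bigr => pi _.
by rewrite expr1n mul1r.
Qed.

Lemma pkdes_at1 (F : fieldType) n (Pi : {set 'S_n}) (t : F) :
  1 + t != 0 ->
  1 / (1 + 1) * ((1 + 1 * t) / (1 - t)) ^+ n.+1 *
    Ppkdes Pi ((1 + 1) ^+ 2 * t / ((1 + t) * (1 + 1 * t)))
              ((1 + t) / (1 + 1 * t)) =
  1 / 2 * ((1 + t) / (1 - t)) ^+ n.+1 * Ppk Pi (4 * t / (1 + t) ^+ 2).
Proof.
move=> t1; rewrite !mul1r divff //; congr (_ * _ * _).
apply: eq_bigr => pi _; rewrite expr1n mulr1; congr ((_ * _ / _) ^+ _).
ring.
Qed.

Lemma tvar_neq0 (K : fieldType) : tvar K != 0.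
Proof. by rewrite tofrac_eq0 polyX_eq0. Qed.

(** For y = 0 a negative letter is 0 and does not act, so this is the peak and
    descent formula for all of S_l, where Q is p_1^l. *)
Lemma expands_eulerian (K : fieldType) (emb : {rmorphism rat -> K}) l :
  expands (eulerian_gf (tvar K) l) (fun k => k%:R ^+ l).
Proof.
case: l => [|l]; first exact: expands_geometric.
(* The expansion Q(S_l) = p_1^l has a single term, so it is indexed by unit. *)
have y1 : 1 + 0 != 0 :> K by rewrite addr0 oner_neq0.
apply: eq_expands (expands_pkdes [set: 'S_l.+1] y1 (ltn0Sn l)).
  by rewrite polyC0 rmorph0 (pkdes_at0 _ (tvar_neq0 K)).
move=> k; pose c (i : unit) : rat := 1; pose ps (i : unit) := nseq l.+1 1%N.
rewrite (superization emb (c := c) (ps := ps)).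
  rewrite /psum_value (big_pred1 tt) => [|[]] //=.
  rewrite rmorph1 mul1r big_nseq.
  rewrite -Monoid.iteropE signed_psum_superblocks oppr0 expr1 subr0 mulr1.
  by [].
move=> N; rewrite (big_pred1 tt) => [|[]] //=; rewrite scale1r big_nseq Qgf_all.
by rewrite -Monoid.iteropE.
Qed.

Lemma parts_gt0 n (la : intpart n) : all (leq 1) (parts la).
Proof. exact: filter_all. Qed.

Lemma size_parts n (la : intpart n) :
  (0 < n)%N -> (0 < size (parts la) < n.+1)%N.
Proof.
case: la => l lP n_gt0; have /andP[_ /eqP sumE] := lP.
apply/andP; split; last first.
  rewrite ltnS /parts /= size_filter (leq_trans (count_size _ _)) //.
  by rewrite size_map size_tuple.
rewrite lt0n /parts /=; apply/negP => /nilP partsE.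
move: n_gt0; rewrite -[X in (0 < X)%N]sumE; move: partsE.
by elim: (map val l) => //= -[|i] s IHs //= /IHs.
Qed.

Lemma sum_by_size (R : nzRingType) (emb : {rmorphism rat -> R}) n
    (P : pred (intpart n)) (c : intpart n -> rat) (G : nat -> R) :
  (0 < n)%N ->
  \sum_(1 <= k < n.+1)
     emb (\sum_(la | P la && (size (parts la) == k)) c la) * G k =
  \sum_(la | P la) emb (c la) * G (size (parts la)).
Proof.
move=> n_gt0; rewrite [RHS](eq_bigr (fun la =>
    \sum_(1 <= k < n.+1 | size (parts la) == k) emb (c la) * G k)); last first.
  move=> la _; rewrite (eq_bigl (fun k => k == size (parts la))).
    by rewrite big_nat1_eq size_parts.
  by move=> k; rewrite eq_sym.
rewrite [RHS](exchange_big_dep predT) //=; apply: eq_bigr => k _.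
by rewrite rmorph_sum mulr_suml.
Qed.

(** * Both expansions of the generating function of Theta *)

Lemma prodr_const_seq (L : nzRingType) (T : Type) (r : seq T) (x : L) :
  \prod_(a <- r) x = x ^+ size r.
Proof. by rewrite big_const_seq count_predT -Monoid.iteropE. Qed.

Definition rat_to_frac (K : fieldType) (emb : {rmorphism rat -> K}) :
  {rmorphism rat -> {fraction {poly K}}} :=
  (@tofrac {poly K}) \o (polyC \o emb).

Lemma expands_Theta_pkdes (K : fieldType) (emb : {rmorphism rat -> K}) (y : K)
    n (Pi : {set 'S_n}) (I : finType) (c : I -> rat) (ps : I -> seq nat) :
  let t := tvar K in let Y := tofrac y%:P in
  (0 < n)%N -> 1 + y != 0 -> (forall i, all (leq 1) (ps i)) ->
  (forall N, Qgf Pi N = \sum_i c i *: \prod_(a <- ps i) psum a N) ->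
  expands (1 / (1 + Y) * ((1 + Y * t) / (1 - t)) ^+ n.+1 *
      Ppkdes Pi ((1 + Y) ^+ 2 * t / ((Y + t) * (1 + Y * t)))
                ((Y + t) / (1 + Y * t)))
    (fun k => Theta y k (Qgf Pi)).
Proof.
move=> t Y n_gt0 y1 ps_gt0 Qc.
apply: eq_expands (expands_pkdes Pi y1 n_gt0); first by [].
move=> k; rewrite (superization emb Qc) (Theta_psums emb y k ps_gt0 Qc).
by apply: eq_psum_value => i a _; rewrite signed_psum_superblocks.
Qed.

Lemma expands_Theta_eulerian (K : fieldType) (emb : {rmorphism rat -> K})
    (y : K) (f : series) (I : finType) (c : I -> rat) (ps : I -> seq nat) :
  (forall i, all (leq 1) (ps i)) ->
  (forall N, f N = \sum_i c i *: \prod_(a <- ps i) psum a N) ->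
  expands (\sum_i ratr (c i) * eulerian_gf (tvar K) (size (ps i)) *
             \prod_(a <- ps i) (1 - (- tofrac y%:P) ^+ a))
    (fun k => Theta y k f).
Proof.
move=> ps_gt0 fE; pose d i := emb (c i) * \prod_(a <- ps i) (1 - (- y) ^+ a).
have := expands_sum (index_enum I) (fun i _ =>
  expandsZ (d i) (expands_eulerian emb (size (ps i)))) (P := predT).
apply: eq_expands => [|k].
  apply: eq_bigr => i _; rewrite -(fmorph_eq_rat (rat_to_frac emb)) /d.
  rewrite !rmorphM /= mulrAC; congr (_ * _ * _).
  rewrite !rmorph_prod; apply: eq_bigr => a _ /=.
  by rewrite !rmorphB !rmorphXn !rmorphN !rmorph1.
rewrite (Theta_psums emb y k ps_gt0 fE); apply: eq_bigr => i _; rewrite /d.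
by rewrite big_split prodr_const_seq /=; ring.
Qed.

Lemma prod_select (L : comNzRingType) (y u : L) (sel : pred nat) (r : seq nat) :
  (forall a, (0 < a)%N -> 1 - (- y) ^+ a = if sel a then u else 0) ->
  all (leq 1) r ->
  \prod_(a <- r) (1 - (- y) ^+ a) = if all sel r then u ^+ size r else 0.
Proof.
move=> selP; elim: r => [|a r IHr] /=; first by rewrite big_nil.
case/andP=> a_gt0 /IHr rE; rewrite big_cons rE selP //.
case: (sel a); last by rewrite mul0r.
by case: (all sel r); rewrite ?exprS ?mulr0.
Qed.

(** If 1 - (- y)^a only takes the value u, when [sel a], and 0, then only the
    partitions whose parts all satisfy [sel] survive. This covers y = 1, with
    u = 2 and odd parts, and y = 0, with u = 1 and all parts. *)
Lemma expands_Theta_select (K : fieldType) (emb : {rmorphism rat -> K})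
    (y u : K) (sel : pred nat) (f : series) (I : finType) (c : I -> rat)
    (ps : I -> seq nat) :
  (forall a, (0 < a)%N -> 1 - (- y) ^+ a = if sel a then u else 0) ->
  (forall i, all (leq 1) (ps i)) ->
  (forall N, f N = \sum_i c i *: \prod_(a <- ps i) psum a N) ->
  expands (\sum_(i | all sel (ps i)) ratr (c i) *
      (tofrac u%:P ^+ size (ps i) * eulerian_gf (tvar K) (size (ps i))))
    (fun k => Theta y k f).
Proof.
move=> selP ps_gt0 fE.
apply: eq_expands (expands_Theta_eulerian emb y ps_gt0 fE) => //.
rewrite [RHS]big_mkcond; apply: eq_bigr => i _.
rewrite (@prod_select _ (tofrac y%:P) (tofrac u%:P) sel) //.
  by case: ifP => _; rewrite ?mulr0 // -mulrA; congr (_ * _); rewrite mulrC.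
move=> a a_gt0; have := congr1 (fun x => tofrac x%:P) (selP a a_gt0).
rewrite !rmorphB !rmorphXn !rmorphN !rmorph1 => ->.
by case: (sel a); rewrite // polyC0 rmorph0.
Qed.

Lemma expands_Theta_by_size (K : fieldType) (emb : {rmorphism rat -> K})
    (y u : K) (sel : pred nat) n (f : series) (c : intpart n -> rat) :
  (0 < n)%N ->
  (forall a, (0 < a)%N -> 1 - (- y) ^+ a = if sel a then u else 0) ->
  (forall N, f N = \sum_(la : intpart n) c la *: psum_part la N) ->
  expands (\sum_(1 <= k < n.+1)
      ratr (\sum_(la | all sel (parts la) && (size (parts la) == k)) c la) *
      (tofrac u%:P ^+ k * eulerian_gf (tvar K) k))
    (fun k => Theta y k f).
Proof.
move=> n_gt0 selP fc.
apply: eq_expands (expands_Theta_select emb selP (@parts_gt0 n) fc) => //.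
under eq_bigr => la _ do rewrite -(fmorph_eq_rat (rat_to_frac emb)).
under [RHS]eq_bigr => k _ do rewrite -(fmorph_eq_rat (rat_to_frac emb)).
by rewrite sum_by_size.
Qed.

(** On k blocks the power sums are k u or 0 according to [sel], so both sides
    agree at the infinitely many points k u. *)
Lemma mpoly_select (y u : rat) (sel : pred nat) n (q : {mpoly rat[n]})
    (f : series) (c : intpart n -> rat) :
  (0 < n)%N -> u != 0 ->
  (forall a, (0 < a)%N -> 1 - (- y) ^+ a = if sel a then u else 0) ->
  (forall N, f N = q \mPo [tuple psum i.+1 N | i < n]) ->
  (forall N, f N = \sum_(la : intpart n) c la *: psum_part la N) ->
  \sum_(1 <= k < n.+1)
    (\sum_(la | all sel (parts la) && (size (parts la) == k)) c la) *: 'X^k =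
  mmap (@polyC rat) (fun i : 'I_n => if sel i.+1 then 'X else 0) q.
Proof.
move=> n_gt0 u0 selP fq fc; pose emb : {rmorphism rat -> rat} := idfun.
under eq_bigr => k _ do rewrite -mul_polyC.
rewrite (sum_by_size (@polyC rat) (fun la => all sel (parts la)) c
  (fun k => 'X^k)) //.
apply: (poly_eq_on_multiples emb u0) => m.
transitivity (mmap emb (fun i : 'I_n => signed_psum i.+1 (superblocks y m)) q).
  rewrite (mpoly_superization emb fq fc) horner_sum big_mkcond.
  apply: eq_bigr => la _ /=.
  under eq_bigr => a _ do rewrite signed_psum_superblocks.
  rewrite big_split prodr_const_seq /=.
  rewrite (prod_select selP (parts_gt0 la)); case: ifP; rewrite ?mulr0 // => _.
  by rewrite hornerM hornerC hornerXn exprMn.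
rewrite -[RHS]/(horner_eval _ _) [in RHS]/mmap rmorph_sum.
apply: eq_bigr => i _.
rewrite /= /horner_eval hornerM hornerC; congr (_ * _).
rewrite /mmap1 horner_prod; apply: eq_bigr => j _; rewrite horner_exp.
rewrite signed_psum_superblocks selP //; congr (_ ^+ _).
by case: ifP; rewrite ?hornerX ?horner0 ?mulr0.
Qed.

Lemma sub1_exprN1 (a : nat) :
  (0 < a)%N -> 1 - (- 1) ^+ a = if odd a then 2 else 0 :> rat.
Proof. by rewrite -signr_odd; case: odd => _; rewrite ?expr0 ?subrr. Qed.

Lemma sub1_exprN0 (a : nat) :
  (0 < a)%N -> 1 - (- 0) ^+ a = if xpredT a then 1 else 0 :> rat.
Proof. by move=> a_gt0; rewrite oppr0 expr0n eqn0Ngt a_gt0 subr0. Qed.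

Theorem theorem3p1 (n : nat) (n_gt0 : (0 < n)%N) (Pi : {set 'S_n})
    (q : {mpoly rat[n]}) (c : intpart n -> rat)
    (Qsym : symfun (Qgf Pi))
    (Qq : forall N, Qgf Pi N = q \mPo [tuple psum i.+1 N | i < n])
    (Qc : forall N, Qgf Pi N = \sum_(la : intpart n) c la *: psum_part la N) :
  (* (a) *)
  (let t := tvar Qy in let y := yc in
   let S := fun k : nat => Theta yvar k (Qgf Pi) in
   expands (1 / (1 + y) * ((1 + y * t) / (1 - t)) ^+ n.+1 *
      Ppkdes Pi ((1 + y) ^+ 2 * t / ((y + t) * (1 + y * t)))
                ((y + t) / (1 + y * t))) S
   /\ expands (\sum_(la : intpart n)
        ratr (c la) * (eulerian (size (parts la)) t /
                       (1 - t) ^+ (size (parts la)).+1) *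
        \prod_(i <- parts la) (1 - (- y) ^+ i)) S) /\
  (* (b) *)
  (let t := tvar rat in
   let S := fun k : nat => Theta (1 : rat) k (Qgf Pi) in
   [/\ expands (1 / 2 * ((1 + t) / (1 - t)) ^+ n.+1 *
         Ppk Pi (4 * t / (1 + t) ^+ 2)) S,
       expands (\sum_(la : intpart n | all odd (parts la))
         ratr (c la) * 2 ^+ size (parts la) *
         (eulerian (size (parts la)) t / (1 - t) ^+ (size (parts la)).+1)) S
     & exists2 a : nat -> rat,
         (* the index i : 'I_n stands for the power sum of degree i + 1 *)
         \sum_(1 <= k < n.+1) a k *: 'X^k =
           mmap (@polyC rat) (fun i : 'I_n => if odd i.+1 then 'X else 0) q
       & expands (\sum_(1 <= k < n.+1)
           ratr (a k) * 2 ^+ k * (eulerian k t / (1 - t) ^+ k.+1)) S]) /\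
  (* (c) *)
  (let t := tvar rat in
   let S := fun k : nat => Theta (0 : rat) k (Qgf Pi) in
   [/\ expands (Ades Pi t / (1 - t) ^+ n.+1) S,
       expands (\sum_(la : intpart n)
         ratr (c la) *
         (eulerian (size (parts la)) t / (1 - t) ^+ (size (parts la)).+1)) S
     & exists2 b : nat -> rat,
         \sum_(1 <= k < n.+1) b k *: 'X^k =
           mmap (@polyC rat) (fun _ : 'I_n => 'X) q
       & expands (\sum_(1 <= k < n.+1)
           ratr (b k) * (eulerian k t / (1 - t) ^+ k.+1)) S]).

Proof.
have Qc' N : Qgf Pi N = \sum_la c la *: \prod_(a <- parts la) psum a N := Qc N.
pose embQ : {rmorphism rat -> rat} := idfun.
pose embQy : {rmorphism rat -> Qy} := (@tofrac {poly rat}) \o polyC.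
have y1 : 1 + yvar != 0.
  rewrite -(rmorph1 (@tofrac _)) -rmorphD; apply: tofrac_coef0_neq0.
  by rewrite !coefE addr0 oner_neq0.
split; [split|split].
- exact: (expands_Theta_pkdes embQy n_gt0 y1 (@parts_gt0 n) Qc').
- exact: (expands_Theta_eulerian embQy yvar (@parts_gt0 n) Qc').
- move=> t S; have y1' : 1 + 1 != 0 :> rat by [].
  have t1 : 1 + t != 0.
    rewrite -(rmorph1 (@tofrac _)) -rmorphD; apply: tofrac_coef0_neq0.
    by rewrite !coefE addr0 oner_neq0.
  have u2 : tofrac 2%:P = 2 :> {fraction {poly rat}} by rewrite !rmorph_nat.
  split.
  + have := expands_Theta_pkdes embQ n_gt0 y1' (@parts_gt0 n) Qc'.
    by rewrite polyC1 rmorph1 (pkdes_at1 _ t1).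
  + apply: eq_expands
      (expands_Theta_select embQ sub1_exprN1 (@parts_gt0 n) Qc'); last by [].
    by apply: eq_bigr => la _; rewrite u2 mulrA.
  exists (fun k =>
      \sum_(la | all odd (parts la) && (size (parts la) == k)) c la).
    exact: mpoly_select sub1_exprN1 Qq Qc.
  apply: eq_expands (expands_Theta_by_size embQ n_gt0 sub1_exprN1 Qc);
    last by [].
  by apply: eq_bigr => k _; rewrite u2 mulrA.
move=> t S; have y1' : 1 + 0 != 0 :> rat by [].
have u1 k : tofrac 1%:P ^+ k = 1 :> {fraction {poly rat}}.
  by rewrite polyC1 rmorph1 expr1n.
split.
- have := expands_Theta_pkdes embQ n_gt0 y1' (@parts_gt0 n) Qc'.
  by rewrite polyC0 rmorph0 (pkdes_at0 _ (tvar_neq0 _)).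
- apply: eq_expands
    (expands_Theta_select (sel := xpredT) embQ sub1_exprN0 (@parts_gt0 n) Qc');
    last by [].
  apply: eq_big => [la|la _]; last by rewrite u1 mul1r.
  exact: all_predT.
exists (fun k =>
    \sum_(la | all xpredT (parts la) && (size (parts la) == k)) c la).
  exact: (mpoly_select (sel := xpredT) n_gt0 (oner_neq0 _) sub1_exprN0 Qq Qc).
apply: eq_expands
  (expands_Theta_by_size (sel := xpredT) embQ n_gt0 sub1_exprN0 Qc); last by [].
by apply: eq_bigr => k _; rewrite u1 mul1r.
Qed.
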